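(* Let $K$ be a field, $S=K[x_1,\ldots,x_n]$, and let $J\subsetneq I\subset S$ be monomial ideals. Let $\overline{I/J}$ be the canonical form of $I/J$. Then the Stanley conjecture holds for $I/J$ if and only if it holds for $\overline{I/J}$; that is, $$\operatorname{sdepth}_S(I/J)\ge\operatorname{depth}_S(I/J)\iff \operatorname{sdepth}_S\big(\overline{I/J}\big)\ge\operatorname{depth}_S\big(\overline{I/J}\big).$$
   Context: Depth is taken with respect to the graded maximal ideal $(x_1,\ldots,x_n)$ of $S$. The Stanley conjecture holds for a graded $S$-module $M$ if $\operatorname{sdepth}_S(M)\ge\operatorname{depth}_S(M)$. Canonical form. For a monomial ideal $L\subset S$, $G(L)$ denotes its minimal system of monomial generators. The power $x_j^r$ enters in a monomial $u$ if $x_j^r\mid u$ but $x_j^{r+1}\nmid u$. Let $J\subsetneq I\subset S$ be monomial ideals. The factor $I/J$ is of type $(k_1,\ldots,k_s)$ with respect to $x_j$ if $1\le k_1<\cdots<k_s$ and $x_j^{k_1},\ldots,x_j^{k_s}$ are exactly the powers of $x_j$ with positive exponent which enter in some monomial of $G(I)\cup G(J)$. The canonical form of $I/J$ with respect to $x_j$ is the factor $I'/J'$, where $I'$ (resp. $J'$) is the ideal generated by the monomials obtained from those of $G(I)$ (resp. $G(J)$) by replacing $x_j^{k_i}$ by $x_j^{i}$ whenever $x_j^{k_i}$ enters in the generator; generators not divisible by $x_j$ are left unchanged. The canonical form $\overline{I/J}$ of $I/J$ is obtained by applying this procedure successively with respect to all variables $x_1,\ldots,x_n$. Stanley depth. Factors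 of monomial ideals are considered with their natural $\mathbb{Z}^n$-grading. A Stanley decomposition of a graded $S$-module $M$ is a finite family $\mathcal D=(S_i,u_i)_{i\in\Lambda}$, where each $u_i\in M$ is homogeneous and each $S_i$ is a graded $K$-algebra retract of $S$ (for the $\mathbb{Z}^n$-grading, $S_i=K[Z_i]$ for a subset $Z_i\subseteq\{x_1,\ldots,x_n\}$), such that $S_i\cap\operatorname{Ann}(u_i)=0$ and $M=\bigoplus_{i\in\Lambda}S_iu_i$ as a graded $K$-vector space. The Stanley depth $\operatorname{sdepth}(\mathcal D)$ of $\mathcal D$ is the depth of the $S$-module $\bigoplus_{i\in\Lambda} S_iu_i$, where each $S_iu_i\cong S_i$ is an $S$-module via the retraction $S\to S_i$; thus $\operatorname{sdepth}(\mathcal D)=\min_i |Z_i|$. The Stanley depth $\operatorname{sdepth}_S(M)$ is the maximum of $\operatorname{sdepth}(\mathcal D)$ over all Stanley decompositions $\mathcal D$ of $M$. *)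

(* Defs.v *)
From HB Require Import structures.
From mathcomp Require Import all_boot all_order all_algebra.
From mathcomp Require Import mpoly.
From mathcomp Require Import boolp.

Set Implicit Arguments.
Unset Strict Implicit.
Unset Printing Implicit Defensive.

Import GRing.Theory.
Local Open Scope ring_scope.
Local Open Scope quotient_scope.

Section QuotientModule.
Variables (R : nzRingType) (V : lmodType R).

Fact submodB (P : submodClosed V) : {in P &, forall x y, x - y \in P}.
Proof. exact: (GRing.submod_closedB (GRing.submodClosedP P)).2. Qed.

Definition submodule (N : submodClosed V) : Type := {x : V | x \in N}.

HB.instance Definition _ N := SubChoice.on (submodule N).
HB.instance Definition _ N :=
  [SubChoice_isSubLmodule of submodule N by <:].

Definition restrict (N P : submodClosed V) : {pred submodule N} :=
  [pred x | val x \in P].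
Arguments restrict : clear implicits.

Fact restrict_zmod_closed N P : zmod_closed (restrict N P).
Proof.
split=> [|x y]; rewrite ?inE; first exact: rpred0.
by rewrite raddfB => xP yP; exact: submodB.
Qed.

HB.instance Definition _ N P :=
  GRing.isZmodClosed.Build _ (restrict N P) (restrict_zmod_closed N P).

(* N / (N \cap P), which is N / P when P is contained in N. *)
Definition quotmod (N P : submodClosed V) : Type :=
  Quotient.quot (restrict N P).

Section Instance.
Variables N P : submodClosed V.

HB.instance Definition _ := Choice.on (quotmod N P).
HB.instance Definition _ := GRing.Zmodule.on (quotmod N P).

Definition quotmod_class (x : submodule N) : quotmod N P :=
  \pi_(Quotient.quot (restrict N P)) x.

Lemma quotmod_classP (x y : submodule N) :
  quotmod_class x = quotmod_class y <-> val x - val y \in P.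
Proof.
split=> [|xyP].
  by move=> /eqP; rewrite -Quotient.idealrBE inE raddfB.
by apply/eqP; rewrite -Quotient.idealrBE inE raddfB.
Qed.

Lemma quotmod_class_surj (u : quotmod N P) : exists x, u = quotmod_class x.
Proof. by exists (repr u); rewrite /quotmod_class reprK. Qed.

Definition quotmod_repr (u : quotmod N P) : submodule N := repr u.

Lemma quotmod_reprK : cancel quotmod_repr quotmod_class.
Proof. by move=> u; rewrite /quotmod_class /quotmod_repr reprK. Qed.

Fact quotmod_class_is_zmod_morphism : zmod_morphism quotmod_class.
Proof. by move=> x y; rewrite /quotmod_class -raddfB. Qed.

HB.instance Definition _ := GRing.isZmodMorphism.Build (submodule N)
  (quotmod N P) quotmod_class quotmod_class_is_zmod_morphism.

Definition quotmod_scale (a : R) (u : quotmod N P) : quotmod N P :=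
  quotmod_class (a *: quotmod_repr u).

Lemma quotmod_scaleE a x :
  quotmod_scale a (quotmod_class x) = quotmod_class (a *: x).
Proof.
apply/quotmod_classP.
have -> : val (a *: quotmod_repr (quotmod_class x)) - val (a *: x) =
    a *: (val (quotmod_repr (quotmod_class x)) - val x) by rewrite scalerBr.
apply: rpredZ; by apply/quotmod_classP; rewrite quotmod_reprK.
Qed.

Fact quotmod_scaleA a b u :
  quotmod_scale a (quotmod_scale b u) = quotmod_scale (a * b) u.
Proof.
by case: (quotmod_class_surj u) => x ->; rewrite !quotmod_scaleE scalerA.
Qed.

Fact quotmod_scale1 : left_id 1 quotmod_scale.
Proof.
by move=> u; case: (quotmod_class_surj u) => x ->; rewrite quotmod_scaleE scale1r.
Qed.

Fact quotmod_scaleDr : right_distributive quotmod_scale +%R.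
Proof.
move=> a u v; case: (quotmod_class_surj u) (quotmod_class_surj v) => x -> [y ->].
by rewrite -raddfD !quotmod_scaleE scalerDr raddfD.
Qed.

Fact quotmod_scaleDl u : {morph quotmod_scale^~ u : a b / a + b}.
Proof.
move=> a b; case: (quotmod_class_surj u) => x ->.
by rewrite !quotmod_scaleE scalerDl raddfD.
Qed.

HB.instance Definition _ := GRing.Zmodule_isLmodule.Build R (quotmod N P)
  quotmod_scaleA quotmod_scale1 quotmod_scaleDr quotmod_scaleDl.

Fact quotmod_class_is_scalable : scalable quotmod_class.
Proof. by move=> a x; rewrite -quotmod_scaleE. Qed.

HB.instance Definition _ := GRing.isScalable.Build R (submodule N)
  (quotmod N P) *:%R quotmod_class quotmod_class_is_scalable.

End Instance.
End QuotientModule.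

(* An ideal of S is an S-submodule of the regular module S^o. *)
Notation ideal K n := (submodClosed {mpoly K[n]}^o).

Section Monomial.
Variables (K : fieldType) (n : nat).
Notation S := {mpoly K[n]}.

Definition monomial_span (A : 'X_{1..n} -> Prop) : {pred S^o} :=
  fun f => `[< exists s : seq (S * 'X_{1..n}),
    (forall t, t \in s -> A t.2) /\ f = \sum_(t <- s) t.1 * 'X_[t.2] >].

Fact monomial_span_submod A : submod_closed (monomial_span A).
Proof.
split; first by apply/asboolP; exists [::]; rewrite big_nil.
move=> a f g /asboolP[s [sA ->]] /asboolP[t [tA ->]]; apply/asboolP.
exists ([seq (a * x.1, x.2) | x <- s] ++ t); split.
  by move=> x; rewrite mem_cat => /orP[/mapP[y /sA ? ->]|/tA].
rewrite big_cat big_map /= /GRing.scale /= mulr_sumr.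
by congr (_ + _); apply: eq_bigr => x _; rewrite mulrA.
Qed.

HB.instance Definition _ A :=
  GRing.isSubmodClosed.Build S S^o (monomial_span A) (monomial_span_submod A).

(* monomial_span A, bundled with the proof that it is an ideal. *)
Definition monomial_gen (A : 'X_{1..n} -> Prop) : ideal K n := monomial_span A.

Definition monomial_ideal (I : ideal K n) : Prop :=
  exists A : 'X_{1..n} -> Prop, I =i monomial_span A.

(* The minimal monomial generators G(L): the monomials of L that are minimal
   for divisibility, which is (_ <= _)%MM on exponents. *)
Definition mingens (L : ideal K n) (u : 'X_{1..n}) : Prop :=
  ('X_[u] : S^o) \in L /\
  forall v : 'X_{1..n}, (v <= u)%MM -> ('X_[v] : S^o) \in L -> v = u.

Lemma mem_monomial_span (A : 'X_{1..n} -> Prop) u :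
  A u -> ('X_[u] : S^o) \in monomial_span A.
Proof.
move=> Au; apply/asboolP; exists [:: (1, u)]; split.
  by move=> t; rewrite inE => /eqP->.
by rewrite big_seq1 mul1r.
Qed.

Lemma monomial_spanP (A : 'X_{1..n} -> Prop) u :
  ('X_[u] : S^o) \in monomial_span A <-> exists2 v, A v & (v <= u)%MM.
Proof.
split=> [/asboolP[s [sA Es]]|[v Av vu]]; last first.
  have := rpredZ ('X_[u - v] : S) (mem_monomial_span Av).
  by rewrite /GRing.scale /= -mpolyXD submK.
have: has (fun t : S * 'X_{1..n} => (t.2 <= u)%MM) s.
  apply/negPn/negP => /hasPn nov.
  have /eqP := congr1 (mcoeff u) Es.
  rewrite mcoeffX eqxx raddf_sum /= big_seq big1 ?oner_eq0 // => t /nov ntu.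
  apply/eqP; rewrite mcoeff_eq0; apply/negP => /msuppM_le.
  rewrite msuppX => /allpairsP[[a b] /= [_]]; rewrite inE => /eqP -> Eu.
  by rewrite Eu lem_addl in ntu.
by case/hasP => t /sA At tu; exists t.2.
Qed.

Lemma mingens_dvd (L : ideal K n) u :
  ('X_[u] : S^o) \in L -> exists2 v, mingens L v & (v <= u)%MM.
Proof.
have [d] := ubnP (mdeg u); elim: d u => // d IHd u lt_ud Lu.
have [[v [vu Lv ne]]|nov] := pselect (exists v, [/\ (v <= u)%MM,
    ('X_[v] : S^o) \in L & v <> u]); last first.
  exists u; last exact: lepm_refl.
  by split=> // v vu Lv; apply: contrapT => ne; apply: nov; exists v.
have lt_vu : (mdeg v < mdeg u)%N.
  rewrite -(submK vu) mdegD -[X in (X < _)%N]add0n ltn_add2r lt0n mdeg_eq0.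
  by apply/eqP => d0; apply: ne; rewrite -(submK vu) d0 add0m.
have [w Lw wv] := IHd v (leq_trans lt_vu lt_ud) Lv.
by exists w => //; apply: lepm_trans vu.
Qed.

(* mingens I generates a monomial ideal I, and is contained in every set of
   monomials generating I. *)
Lemma mingens_span (I : ideal K n) :
  monomial_ideal I -> I =i monomial_span (mingens I).
Proof.
case=> A IA f; apply/idP/idP => [|/asboolP[s [sG ->]]]; last first.
  rewrite big_seq; apply: rpred_sum => t /sG[It _].
  exact: (rpredZ (t.1 : S) It).
rewrite IA => /asboolP[s [sA ->]]; rewrite big_seq; apply: rpred_sum => t ts.
apply: (@rpredZ _ _ (monomial_span (mingens I)) t.1).
apply/monomial_spanP; apply: mingens_dvd.
by rewrite IA; apply: mem_monomial_span; exact: sA.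
Qed.

Lemma mingens_min (I : ideal K n) (A : 'X_{1..n} -> Prop) :
  I =i monomial_span A -> forall u, mingens I u -> A u.
Proof.
move=> IA u [Iu min_u]; move: (Iu); rewrite IA => /monomial_spanP[v Av vu].
by rewrite -(min_u v vu) // IA; apply: mem_monomial_span.
Qed.

(* The positive powers of x_j entering in the monomials of G(I) u G(J). *)
Definition enters (I J : ideal K n) (j : 'I_n) (k : nat) : Prop :=
  (0 < k)%N /\ exists2 u, mingens I u \/ mingens J u & u j = k.

(* If k_1 < ... < k_s are the entering powers, the number of those that are
   at most k_i is i, and none is at most 0: this realizes k_i |-> i, 0 |-> 0. *)
Definition canonical_exp (I J : ideal K n) (j : 'I_n) (k : nat) : nat :=
  count (fun l => `[< enters I J j l >]) (iota 1 k).

(* I / J is of type ks with respect to x_j. *)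
Definition factor_type (I J : ideal K n) (j : 'I_n) (ks : seq nat) : Prop :=
  sorted ltn ks /\ forall k, k \in ks <-> enters I J j k.

Lemma canonical_exp_type I J j ks i : factor_type I J j ks ->
  (i < size ks)%N -> canonical_exp I J j (nth 0%N ks i) = i.+1.
Proof.
move=> [ks_sorted ksP] lt_i; rewrite /canonical_exp -size_filter.
suff -> : [seq l <- iota 1 (nth 0%N ks i) | `[< enters I J j l >]] = take i.+1 ks.
  by rewrite size_takel.
apply: (irr_sorted_eq ltn_trans ltnn).
- by apply: sorted_filter (iota_ltn_sorted _ _); exact: ltn_trans.
- exact: take_sorted.
move=> l; rewrite mem_filter mem_iota add1n ltnS; apply/idP/idP.
  case/and3P => /asboolP/ksP lks _; rewrite -{1}(nth_index 0%N lks) => le_l.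
  rewrite in_take // ltnS leqNgt; apply/negP => lt_il; move: le_l.
  by rewrite leqNgt (sorted_ltn_nth ltn_trans) // inE // index_mem.
move=> lt; have lks := mem_take lt; have [l0 _] := (ksP l).1 lks.
rewrite l0 /=; apply/andP; split; first exact/asboolP/ksP.
rewrite in_take // ltnS in lt; rewrite -{1}(nth_index 0%N lks).
have [->//|ne] := eqVneq (index l ks) i.
by rewrite ltnW // (sorted_ltn_nth ltn_trans) // ?inE ?index_mem // ltn_neqAle ne.
Qed.

Definition canonical_mon (I J : ideal K n) (j : 'I_n) (u : 'X_{1..n}) :
    'X_{1..n} :=
  [multinom if i == j then canonical_exp I J j (u j) else u i | i < n].

Definition canonical_step (IJ : ideal K n * ideal K n) (j : 'I_n) :
    ideal K n * ideal K n :=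
  let image (L : ideal K n) v :=
    exists2 u, mingens L u & v = canonical_mon IJ.1 IJ.2 j u in
  (monomial_gen (image IJ.1), monomial_gen (image IJ.2)).

Definition canonical_form (I J : ideal K n) : ideal K n * ideal K n :=
  foldl canonical_step (I, J) (enum 'I_n).

End Monomial.

Arguments monomial_span {K n} A.
Arguments monomial_gen {K n} A.

(* The value is 0 if P has no largest element. This does not occur below for
   M = I / J with J a proper subset of I: regular sequences on M in the maximal
   ideal have length at most n, and M has a Stanley decomposition. *)
Definition natmax (P : nat -> Prop) : nat :=
  if pselect (exists m, P m /\ forall k, P k -> (k <= m)%N) is left exP
  then sval (cid exP) else 0%N.

Lemma natmaxP (P : nat -> Prop) m :
  P m -> (forall k, P k -> (k <= m)%N) -> natmax P = m.
Proof.
move=> Pm maxm; rewrite /natmax; case: pselect => [exP|[]]; last by exists m.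
case: (cid exP) => k [Pk maxk] /=.
by apply/eqP; rewrite eqn_leq maxm //= maxk.
Qed.

Section Depth.
Variables (K : fieldType) (n : nat) (M : lmodType {mpoly K[n]}).
Notation S := {mpoly K[n]}.

(* v belongs to the submodule (f_1, ..., f_r) M. *)
Definition in_mulmod (fs : seq S) (v : M) : Prop :=
  exists w : 'I_(size fs) -> M, v = \sum_(i < size fs) fs`_i *: w i.

Definition regular_sequence (fs : seq S) : Prop :=
  (forall i, (i < size fs)%N -> forall v : M,
     in_mulmod (take i fs) (fs`_i *: v) -> in_mulmod (take i fs) v) /\
  exists v : M, ~ in_mulmod fs v.

Definition graded_maximal_ideal : ideal K n :=
  monomial_gen (fun u => exists i : 'I_n, u = U_(i)%MM).

Definition depth : nat := natmax (fun r => exists fs : seq S,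
  [/\ size fs = r, {subset fs <= graded_maximal_ideal}
    & regular_sequence fs]).

End Depth.

Section StanleyDepth.
Variables (K : fieldType) (n : nat).
Notation S := {mpoly K[n]}.

(* The retract K[Z] of S. *)
Definition in_retract (Z : {set 'I_n}) (p : S) : Prop :=
  forall m, m \in msupp p -> forall i, i \notin Z -> m i = 0%N.

(* The grading of M enters only through its homogeneous elements: a subspace
   K[Z] u with u homogeneous is automatically a graded one. *)
Variables (M : lmodType S) (homogeneous : M -> Prop).

Record stanley_decomposition (r : nat) (Z : 'I_r -> {set 'I_n})
    (u : 'I_r -> M) : Prop := StanleyDecomposition {
  stanley_homogeneous : forall i, homogeneous (u i);
  stanley_ann : forall i p, in_retract (Z i) p -> p *: u i = 0 -> p = 0;
  stanley_span : forall v, exists2 p : 'I_r -> S,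
    forall i, in_retract (Z i) (p i) & v = \sum_(i < r) p i *: u i;
  stanley_direct : forall p : 'I_r -> S,
    (forall i, in_retract (Z i) (p i)) -> \sum_(i < r) p i *: u i = 0 ->
    forall i, p i *: u i = 0
}.

(* The depth of the direct sum of the S-modules K[Z i]. Each #|Z i| is at most
   n, so the default value n matters only for the empty decomposition of 0. *)
Definition sdepth_decomposition (r : nat) (Z : 'I_r -> {set 'I_n}) : nat :=
  \big[minn/n]_(i < r) #|Z i|.

Definition sdepth : nat := natmax (fun d =>
  exists (r : nat) (Z : 'I_r -> {set 'I_n}) (u : 'I_r -> M),
    stanley_decomposition Z u /\ sdepth_decomposition Z = d).

End StanleyDepth.

Section Factor.
Variables (K : fieldType) (n : nat) (I J : ideal K n).
Notation S := {mpoly K[n]}.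

Definition factor : lmodType S := quotmod I J.

(* The component of degree a of I / J, for the Z^n-grading; the degrees outside
   N^n, where it vanishes, are left out. *)
Definition factor_component (a : 'X_{1..n}) (u : factor) : Prop :=
  exists2 x : submodule I, u = quotmod_class J x &
    exists c : K, val x = c%:MP * 'X_[a] :> S.

Definition factor_homogeneous (u : factor) : Prop :=
  exists a, factor_component a u.

Definition stanley_conjecture : Prop :=
  (depth factor <= sdepth factor_homogeneous)%N.

End Factor.

(* Main.v *)
Require Import Defs.
From HB Require Import structures.
From mathcomp Require Import all_boot all_order all_algebra.
From mathcomp Require Import ssrcomplements mpoly.
From mathcomp Require Import boolp.

(* One canonical step in x_j does not change depth and sdepth. Let c send an exponent
   e to the number of powers of x_j entering in G(I) and G(J) that are at most e. Then
   x^a lies in I (or J) iff its image under c in x_j lies in I' (or J').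
   - sdepth: pulling a partition of the monomials of I' \ J' into cones u K[Z] back
     along c, or one of I \ J along the minimal section of c, keeps all the sets Z.
   - depth: since S is noetherian, I / J has a regular sequence of length r in the
     graded maximal ideal iff the Koszul cohomology of x_1, ..., x_n on I / J vanishes
     below degree r. In a multidegree whose x_j-component is not a jump of c the Koszul
     complex is contracted by the inverse of x_j; in the other multidegrees it is a
     strand of the Koszul complex on I' / J', and every strand of the latter occurs. *)

Set Implicit Arguments.
Unset Strict Implicit.
Unset Printing Implicit Defensive.

Import Order.TTheory GRing.Theory.
Local Open Scope ring_scope.

(** * Koszul complexes *)

(** A regular sequence may consist of inhomogeneous elements, so there is no multidegree in which
    those of two factors could be compared; vanishing of Koszul cohomology is a condition on each
    multidegree separately. Neither iterated quotients nor cohomology modules are formed: predicates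
    P, Q on an ambient module V stand for P modulo Q, dividing by f only enlarges Q, and a cocycle
    is a cochain in P whose differential lies in Q. The comparison maps change the exponent of x_j,
    so they are merely K-linear and do not commute with x_j. Hence the Koszul complex is built as an
    iterated cone with x_j outermost, and one map acts on the source of x_j, another one on its
    target. Noetherianity enters at a single place: to find a nonzerodivisor once the cohomology in
    degree 0 vanishes. *)

Definition is_submod (R : nzRingType) (V : lmodType R) (Q : V -> Prop) :=
  Q 0 /\ forall a u v, Q u -> Q v -> Q (a *: u + v).

Section Submodules.
Variables (R : comNzRingType) (V : lmodType R).
Implicit Types (P Q : V -> Prop) (f : R).

Lemma smodD Q u v : is_submod Q -> Q u -> Q v -> Q (u + v).
Proof. by move=> [_ QL] Qu Qv; rewrite -[u]scale1r; apply: QL. Qed.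

Lemma smodZ Q a u : is_submod Q -> Q u -> Q (a *: u).
Proof. by move=> [Q0 QL] Qu; rewrite -[_ *: _]addr0; apply: QL. Qed.

Lemma smodN Q u : is_submod Q -> Q u -> Q (- u).
Proof. by move=> sQ Qu; rewrite -scaleN1r; apply: smodZ. Qed.

Lemma smodB Q u v : is_submod Q -> Q u -> Q v -> Q (u - v).
Proof. by move=> sQ Qu Qv; apply: smodD => //; apply: smodN. Qed.

Lemma smod_sum Q (I : Type) (r : seq I) (c : pred I) (F : I -> V) :
  is_submod Q -> (forall i, c i -> Q (F i)) -> Q (\sum_(i <- r | c i) F i).
Proof.
by move=> sQ QF; apply: big_ind => //; [case: sQ|move=> u v; apply: smodD].
Qed.

Fixpoint span (xs : seq V) : V -> Prop :=
  if xs is x :: xs' then fun v => exists c w, span xs' w /\ v = c *: x + w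
  else fun v => v = 0.

Lemma span_submod xs : is_submod (span xs).
Proof.
elim: xs => [|x xs [IH0 IHL]] /=.
  by split=> // a u v -> ->; rewrite scaler0 addr0.
split=> [|a _ _ [c [w [sw ->]]] [d [u [su ->]]]].
  by exists 0, 0; rewrite scale0r addr0.
exists (a * c + d), (a *: w + u); split; first exact: IHL.
by rewrite scalerDr scalerDl scalerA addrACA.
Qed.

Lemma mem_span xs x : x \in xs -> span xs x.
Proof.
elim: xs => //= y xs IH; rewrite inE => /orP[/eqP->|/IH sx].
  by exists 1, 0; rewrite scale1r addr0; split=> //; case: (span_submod xs).
by exists 0, x; rewrite scale0r add0r.
Qed.

Lemma span_min xs Q v :
  is_submod Q -> (forall x, x \in xs -> Q x) -> span xs v -> Q v.
Proof.
move=> [Q0 QL]; elim: xs v => [|x xs IH] v xsQ /=; first by move=> ->.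
case=> c [w [/IH Qw ->]]; apply: QL; first by apply: xsQ; rewrite mem_head.
by apply: Qw => y ys; apply: xsQ; rewrite inE ys orbT.
Qed.
End Submodules.

Section Koszul.
Variables (R : comNzRingType) (V : lmodType R).
Implicit Types (P Q : V -> Prop) (f : R).

(** The quotient of P / Q by f is again given by a pair, with the same P. *)
Definition sum_mul P Q f : V -> Prop :=
  fun v => exists p q, [/\ P p, Q q & v = f *: p + q].

Lemma sum_mul_submod P Q f :
  is_submod P -> is_submod Q -> is_submod (sum_mul P Q f).
Proof.
move=> sP sQ; split=> [|a _ _ [p [q [Pp Qq ->]]] [p' [q' [Pp' Qq' ->]]]].
  by exists 0, 0; rewrite scaler0 addr0; split=> //; [case: sP|case: sQ].
exists (a *: p + p'), (a *: q + q'); split; [by apply sP|by apply sQ|].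
by rewrite !scalerDr !scalerA mulrC addrACA.
Qed.

Lemma sum_mul_r P Q f v : is_submod P -> Q v -> sum_mul P Q f v.
Proof. by move=> [P0 _] Qv; exists 0, v; rewrite scaler0 add0r. Qed.

Definition nonzerodivisor P Q f := forall v, P v -> Q (f *: v) -> Q v.

(** Nonvanishing of the last quotient is left to [depth_factorP]. *)
Fixpoint regular_on P Q (fs : seq R) : Prop :=
  if fs is f :: fs' then nonzerodivisor P Q f /\ regular_on P (sum_mul P Q f) fs'
  else True.

(** One copy of V for each subset of [xs]: [z.1] holds the subsets without x, [z.2] those with x,
    which sit one degree higher. *)
Fixpoint cochain (xs : seq R) : lmodType R :=
  if xs is _ :: xs' then (cochain xs' * cochain xs')%type else V.

(* The Koszul complex of x :: xs is the cone of x acting on that of xs. *)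
Fixpoint kdiff xs : cochain xs -> cochain xs :=
  match xs with
  | [::] => fun _ => 0
  | x :: xs' => fun z => (kdiff z.1, x *: z.1 - kdiff z.2)
  end.

Fixpoint in_all xs Q : cochain xs -> Prop :=
  match xs with
  | [::] => fun z => Q z
  | x :: xs' => fun z => in_all Q z.1 /\ in_all Q z.2
  end.

(* The components of cohomological degree less than r. *)
Fixpoint trunc xs (r : nat) : cochain xs -> cochain xs :=
  match xs with
  | [::] => fun z => if r is 0 then 0 else z
  | x :: xs' => fun z => (trunc r z.1, trunc r.-1 z.2)
  end.

Fixpoint cmap xs (L : V -> V) : cochain xs -> cochain xs :=
  match xs with
  | [::] => fun z => L z
  | x :: xs' => fun z => (cmap L z.1, cmap L z.2)
  end.

Lemma cochain_consP x xs (z w : cochain (x :: xs)) : z.1 = w.1 -> z.2 = w.2 -> z = w.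
Proof. by case: z w => [a b] [c d] /= -> ->. Qed.

Lemma kdiff_lin xs a (z w : cochain xs) :
  kdiff (a *: z + w) = a *: kdiff z + kdiff w.
Proof.
elim: xs z w => [|x xs IH] /= z w; first by rewrite scaler0 addr0.
rewrite !IH; apply: (cochain_consP (x := x)) => //=.
by rewrite !scalerDr !scalerN !scalerA mulrC opprD addrACA.
Qed.

Lemma kdiff0 xs : kdiff (0 : cochain xs) = 0.
Proof. by have := kdiff_lin (-1) (0 : cochain xs) 0; rewrite scaler0 addr0 scaleN1r addNr. Qed.

Lemma kdiffZ xs a (z : cochain xs) : kdiff (a *: z) = a *: kdiff z.
Proof. by rewrite -{1}[a *: z]addr0 kdiff_lin kdiff0 addr0. Qed.

Lemma kdiffD xs (z w : cochain xs) : kdiff (z + w) = kdiff z + kdiff w.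
Proof. by rewrite -{1}[z]scale1r kdiff_lin scale1r. Qed.

Lemma kdiffB xs (z w : cochain xs) : kdiff (z - w) = kdiff z - kdiff w.
Proof. by rewrite kdiffD -scaleN1r kdiffZ scaleN1r. Qed.

Lemma kdiffK xs (z : cochain xs) : kdiff (kdiff z) = 0.
Proof.
elim: xs z => [|x xs IH] //= z; rewrite IH; apply: (cochain_consP (x := x)) => //=.
by rewrite kdiffB kdiffZ IH subr0 subrr.
Qed.

Lemma in_all_submod xs Q : is_submod Q -> is_submod (@in_all xs Q).
Proof.
move=> sQ; elim: xs => [|x xs [IH0 IHL]] //=.
by split=> [|a u v [? ?] [? ?]]; split => //; apply: IHL.
Qed.

Lemma in_all_sub xs P Q (z : cochain xs) :
  (forall v, P v -> Q v) -> in_all P z -> in_all Q z.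
Proof.
by move=> PQ; elim: xs z => [|x xs IH] /= z; [exact: PQ|case; split; exact: IH].
Qed.

Lemma in_all_sum_mul xs P Q f (z : cochain xs) : in_all (sum_mul P Q f) z ->
  exists w q, [/\ in_all P w, in_all Q q & z = f *: w + q].
Proof.
elim: xs z => [|x xs IH] //= [a b] /= [/IH[w [q [Pw Qq ->]]] /IH[w' [q' [Pw' Qq' ->]]]].
by exists (w, w'), (q, q').
Qed.

Lemma in_all_mul xs P Q f (z : cochain xs) :
  is_submod Q -> in_all P z -> in_all (sum_mul P Q f) (f *: z).
Proof.
move=> [Q0 _]; elim: xs z => [|x xs IH] /= z; last by case; split; apply: IH.
by move=> Pz; exists z, 0; rewrite addr0.
Qed.

Lemma nonzerodivisor_in_all xs P Q f (z : cochain xs) :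
  nonzerodivisor P Q f -> in_all P z -> in_all Q (f *: z) -> in_all Q z.
Proof.
move=> fP; elim: xs z => [|x xs IH] /= z; first exact: fP.
by move=> [? ?] [? ?]; split; apply: IH.
Qed.

Lemma kdiff_in xs Q (z : cochain xs) :
  is_submod Q -> in_all Q z -> in_all Q (kdiff z).
Proof.
move=> sQ; elim: xs z => [|x xs IH] /= z; first by case: sQ.
case=> z1 z2; split; first exact: IH.
have sC := in_all_submod xs sQ.
by apply: (smodB sC); [exact: smodZ sC _|exact: IH].
Qed.

Lemma trunc_in xs r Q (z : cochain xs) :
  is_submod Q -> in_all Q z -> in_all Q (trunc r z).
Proof.
move=> sQ; elim: xs r z => [|x xs IH] r /= z; first by case: r; case: sQ.
by case=> z1 z2; split; apply: IH.
Qed.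

Lemma trunc_lin xs r a (z w : cochain xs) :
  trunc r (a *: z + w) = a *: trunc r z + trunc r w.
Proof.
elim: xs r z w => [|x xs IH] r /= z w; first by case: r => //; rewrite scaler0 addr0.
by rewrite !IH.
Qed.

Lemma trunc0 xs (z : cochain xs) : trunc 0 z = 0.
Proof. by elim: xs z => [|x xs IH] //= z; rewrite !IH. Qed.

Lemma truncZ xs a r (z : cochain xs) : trunc r (a *: z) = a *: trunc r z.
Proof.
elim: xs r z => [|x xs IH] r /= z; first by case: r => //; rewrite scaler0.
by rewrite !IH.
Qed.

Lemma truncB xs r (z w : cochain xs) : trunc r (z - w) = trunc r z - trunc r w.
Proof. by rewrite addrC -scaleN1r trunc_lin scaleN1r addrC. Qed.

Lemma trunc_id xs r (z : cochain xs) : trunc r (trunc r z) = trunc r z.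
Proof. by elim: xs r z => [|x xs IH] [|r] //= z; rewrite !IH. Qed.

Lemma trunc_trunc xs r (z : cochain xs) : trunc r.+1 (trunc r z) = trunc r z.
Proof.
elim: xs r z => [|x xs IH] [|r] //= z; rewrite ?IH //.
by rewrite !trunc0.
Qed.

Lemma trunc_kdiff xs r (z : cochain xs) : trunc r.+1 (kdiff z) = kdiff (trunc r z).
Proof.
elim: xs r z => [|x xs IH] r /= z; first by [].
rewrite IH; apply: (cochain_consP (x := x)) => //=.
rewrite addrC -scaleN1r trunc_lin truncZ scaleN1r addrC; congr (_ - _).
by case: r => [|r] /=; rewrite ?IH // !trunc0 kdiff0.
Qed.

(** h is contraction against the coefficients of f. For f = c x + g it carries the second half of
    the cone back to the first by c, and acts on both halves by the homotopy of g, with a sign on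
    the second. The last two clauses say that h respects submodules and lowers the degree by one. *)
Lemma koszul_homotopy xs f : span (V := R^o) xs f ->
  exists h : cochain xs -> cochain xs,
  [/\ forall a z w, h (a *: z + w) = a *: h z + h w,
      forall z, kdiff (h z) + h (kdiff z) = f *: z,
      forall Q z, is_submod Q -> in_all Q z -> in_all Q (h z)
    & forall r z, h (trunc r z) = trunc r.-1 (h z)].
Proof.
elim: xs f => [|x xs IH] f /=.
  move=> ->; exists (fun _ => 0); split=> [a z w|z|Q z []|r z] //.
  - by rewrite scaler0 addr0.
  - by rewrite addr0 scale0r.
  - by case: r => [|[]].
case=> c [g [/IH[h [hl hd hQ ht]] ->]].
have hZ a z : h (a *: z) = a *: h z.
  have h0 : h 0 = 0 by have := hl (-1) 0 0; rewrite scaler0 addr0 scaleN1r addNr.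
  by rewrite -{1}[a *: z]addr0 hl h0 addr0.
exists (fun z => (h z.1 + c *: z.2, - h z.2)).
split=> [a [z1 z2] [w1 w2]|[a b]|Q [a b] sQ [/= Qa Qb]|r [a b]] /=.
- apply: (cochain_consP (x := x)) => /=.
    by rewrite !hl scalerDr !scalerDr !scalerA [c * a]mulrC addrACA.
  by rewrite hl scalerN opprD.
- apply: (cochain_consP (x := x)) => /=; rewrite scalerDl.
    rewrite kdiffD kdiffZ scalerBr scalerA addrACA hd -[c *: x]/(c * x).
    by rewrite [X in _ + X = _]addrC subrK addrC.
  have -> : h (x *: a - kdiff b) = x *: h a - h (kdiff b).
    by rewrite addrC -scaleN1r hl hZ scaleN1r addrC.
  rewrite -(hd b) -[- h b]scaleN1r kdiffZ scaleN1r opprK opprB scalerDr scalerA.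
  rewrite -[c *: x]/(c * x) [x * c]mulrC [x *: h a + _]addrC -!addrA; congr (_ + _).
  by rewrite addrC -!addrA addNr addr0.
- have sC := in_all_submod xs sQ; split; last by apply: (smodN sC); apply: hQ.
  by apply: (smodD sC); [exact: hQ|exact: smodZ sC _].
- by rewrite !ht -[- h b]scaleN1r truncZ scaleN1r [h a + _]addrC trunc_lin addrC.
Qed.

(** Vanishing of the cohomology of P / Q in all degrees less than r at once: an inhomogeneous
    cochain is a cocycle modulo Q iff each of its components is. *)
Definition acyclic_below xs r P Q := forall z : cochain xs, in_all P z ->
  in_all Q (kdiff (trunc r z)) ->
  exists2 w, in_all P w & in_all Q (trunc r z - kdiff w).

Lemma acyclic_below0 xs P Q : is_submod P -> is_submod Q -> acyclic_below xs 0 P Q.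
Proof.
move=> sP sQ z _ _; exists 0; first by case: (in_all_submod xs sP).
by rewrite trunc0 kdiff0 subrr; case: (in_all_submod xs sQ).
Qed.

(* f is null-homotopic on the Koszul complex, hence kills its cohomology. *)
Lemma acyclic_below_sum_mul xs r P Q f :
  is_submod P -> is_submod Q -> span (V := R^o) xs f -> nonzerodivisor P Q f ->
  acyclic_below xs r.+1 P Q <-> acyclic_below xs r P (sum_mul P Q f).
Proof.
move=> sP sQ xs_f fP; have sP' := in_all_submod xs sP.
have sQ' := in_all_submod xs sQ.
have sF := sum_mul_submod f sP sQ; have sF' := in_all_submod xs sF.
have regf (z : cochain xs) := @nonzerodivisor_in_all xs P Q f z fP.
split=> acyc z Pz.
  (* Connecting homomorphism of multiplication by f: the truncated [w0] is a cocycle modulo Q,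
     because f can be cancelled. Its degree is at most r, so it is the coboundary of some u modulo
     Q, and z - f u, truncated, is a cocycle modulo Q. *)
  move=> /in_all_sum_mul[w0 [q0 [Pw0 Qq0 dz]]].
  have {dz} dz : kdiff (trunc r z) = f *: trunc r.+1 w0 + trunc r.+1 q0.
    by rewrite -trunc_lin -dz trunc_kdiff trunc_id.
  have {Qq0} Qq := trunc_in r.+1 sQ Qq0.
  have Qdw : in_all Q (kdiff (trunc r.+1 w0)).
    apply: regf; first by apply: kdiff_in => //; exact: trunc_in.
    rewrite -kdiffZ -[f *: _](addrK (trunc r.+1 q0)) -dz kdiffB kdiffK sub0r.
    by apply: (smodN sQ'); apply: kdiff_in.
  have [u Pu Qu] := acyc _ Pw0 Qdw.
  pose y := trunc r z - f *: trunc r u.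
  have Py : in_all P y.
    apply: (smodB sP'); first exact: trunc_in.
    by apply: (smodZ _ sP'); apply: trunc_in.
  have yE : trunc r.+1 y = y by rewrite truncB truncZ !trunc_trunc.
  have Qdy : in_all Q (kdiff (trunc r.+1 y)).
    rewrite yE kdiffB kdiffZ dz -trunc_kdiff addrAC -scalerBr.
    rewrite -[trunc r.+1 w0]trunc_id -truncB; apply: (smodD sQ') => //.
    by apply: (smodZ _ sQ'); apply: trunc_in.
  have [v Pv Qv] := acyc _ Py Qdy.
  exists v => //; rewrite yE in Qv.
  rewrite -[trunc r z](subrK (f *: trunc r u)) -/y addrAC.
  apply: (smodD sF'); last by apply: in_all_mul => //; exact: trunc_in.
  by apply: in_all_sub Qv => q; apply: sum_mul_r.
move=> Qdz.
(* As d h y agrees with f y modulo Q, [h y] is a cocycle modulo [sum_mul P Q f] in degrees below r.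
   Writing it as d u + f w + q puts f (y - d w) into Q, and f can be cancelled. *)
have [h [hl hd hQ ht]] := koszul_homotopy xs_f.
have hP : in_all P (h z) by apply: hQ.
set y := trunc r.+1 z in Qdz *.
have Py : in_all P y by apply: trunc_in.
have thE : trunc r (h z) = h y by rewrite ht.
have Fdhy : in_all (sum_mul P Q f) (kdiff (h y)).
  rewrite -[kdiff _](addrK (h (kdiff y))) hd; apply: (smodB sF').
    exact: in_all_mul.
  by apply: in_all_sub (hQ _ _ sQ Qdz) => q; apply: sum_mul_r.
have [|u Pu] := acyc (h z) hP; first by rewrite thE.
rewrite thE => /in_all_sum_mul[w [q [Pw Qq hyE]]].
exists w => //; apply: regf.
  by apply: (smodB sP') => //; apply: kdiff_in.
rewrite scalerBr -hd -[h y](subrK (kdiff u)) hyE !kdiffD kdiffK addr0 kdiffZ.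
rewrite [X in in_all _ (X - _)]addrC [f *: _ + _]addrC addrA addrK.
by apply: (smodD sQ'); [exact: hQ|exact: kdiff_in].
Qed.

Fixpoint cochain0 xs (v : V) : cochain xs :=
  if xs is x :: xs' then (cochain0 xs' v, 0) else v.

(** An element killed by [xs] modulo Q is a cocycle in degree 0, where the only coboundary is 0. *)
Lemma acyclic_below_socle xs r P Q v : is_submod P -> is_submod Q ->
  acyclic_below xs r.+1 P Q -> P v ->
  (forall x, x \in xs -> Q (x *: v)) -> Q v.
Proof.
move=> sP sQ acyc Pv xsv.
have Pz : in_all P (cochain0 xs v).
  elim: (xs) => //= _ ys IH; split=> //; by case: (in_all_submod ys sP).
have tz : trunc r.+1 (cochain0 xs v) = cochain0 xs v.
  elim: (xs) => //= _ ys ->; rewrite -[in LHS](scale0r 0) truncZ scale0r //.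
have [|w _] := acyc _ Pz.
  rewrite tz; elim: (xs) xsv => [|y ys IH] ysv /=; first by case: sQ.
  split; first by apply: IH => x xys; apply: ysv; rewrite inE xys orbT.
  rewrite kdiff0 subr0.
  have: Q (y *: v) by apply: ysv; rewrite mem_head.
  elim: (ys) => //= _ zs IHz Qyv; split; first exact: IHz.
  rewrite scaler0; by case: (in_all_submod zs sQ).
rewrite tz; elim: (xs) w => [|y ys IH] /= w; first by rewrite subr0.
by case=> /IH.
Qed.
End Koszul.

(** * Transfer of acyclicity along homotopies *)

Section Transfer.
Variables (R : comNzRingType) (V : lmodType R).
Implicit Types (P Q : V -> Prop) (L : V -> V).

(** The identity on the cohomology of P / Q factors through that of P' / Q', because h joins F G to
    the identity. The converse passage is a second application with F and G exchanged. *)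
Lemma acyclic_below_homotopy xs r P Q P' Q' (F G h : cochain V xs -> cochain V xs) :
  is_submod P -> is_submod Q ->
  {morph F : z w / z - w} ->
  (forall z, F (kdiff z) = kdiff (F z)) -> (forall z, G (kdiff z) = kdiff (G z)) ->
  (forall z, G (trunc r z) = trunc r (G z)) ->
  (forall z, in_all P' z -> in_all P (F z)) ->
  (forall z, in_all Q' z -> in_all Q (F z)) ->
  (forall z, in_all P z -> in_all P' (G z)) ->
  (forall z, in_all Q z -> in_all Q' (G z)) ->
  (forall z, in_all P z -> in_all P (h z)) ->
  (forall z, in_all Q z -> in_all Q (h z)) ->
  (forall z, z - F (G z) = kdiff (h z) + h (kdiff z)) ->
  acyclic_below xs r P' Q' -> acyclic_below xs r P Q.
Proof.
move=> sP sQ FB Fd Gd Gt FP FQ GP GQ hP hQ hE acyc z Pz Qdz.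
have sP' := in_all_submod xs sP; have sQ' := in_all_submod xs sQ.
have [|w Pw Qw] := acyc (G z) (GP _ Pz); first by rewrite -Gt -Gd; apply: GQ.
exists (F w + h (trunc r z)).
  by apply: (smodD sP'); [exact: FP|apply: hP; exact: trunc_in].
have -> : trunc r z - kdiff (F w + h (trunc r z)) =
    F (trunc r (G z) - kdiff w) + h (kdiff (trunc r z)).
  rewrite kdiffD -Gt FB Fd -{1}[trunc r z](subrK (F (G (trunc r z)))) hE.
  apply/eqP; rewrite subr_eq [X in _ == X + _]addrAC [kdiff (F w) + _ in eqbRHS]addrC.
  by rewrite [eqbRHS]addrCA subrK -addrA [h _ + F _]addrC.
by apply: (smodD sQ'); [exact: FQ|exact: hQ].
Qed.

Lemma cmapB xs L (z w : cochain V xs) :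
  {morph L : u v / u - v} -> cmap L (z - w) = cmap L z - cmap L w.
Proof. by move=> LB; elim: xs z w => [|x xs IH] z w /=; rewrite ?LB ?IH. Qed.

Lemma cmap_kdiff xs L (z : cochain V xs) : {morph L : u v / u - v} ->
  (forall x v, x \in xs -> L (x *: v) = x *: L v) ->
  cmap L (kdiff z) = kdiff (cmap L z).
Proof.
move=> LB; have L0 : L 0 = 0 by have := LB 0 0; rewrite !subrr.
elim: xs z => [|x xs IH] z LZ /=; first by [].
have LZ' y v : y \in xs -> L (y *: v) = y *: L v.
  by move=> yxs; apply: LZ; rewrite inE yxs orbT.
rewrite IH // cmapB // IH //; apply: (cochain_consP (x := x)) => //=.
congr (_ - _); elim: (xs) (z.1) => [|y ys IHy] v /=.
  by apply: LZ; rewrite mem_head.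
by rewrite !IHy.
Qed.

Lemma cmap_trunc xs r L (z : cochain V xs) :
  L 0 = 0 -> cmap L (trunc r z) = trunc r (cmap L z).
Proof.
by move=> L0; elim: xs r z => [|x xs IH] r z /=; [case: r|rewrite !IH].
Qed.

Lemma cmap_in xs P P' L (z : cochain V xs) :
  (forall v, P v -> P' (L v)) -> in_all P z -> in_all P' (cmap L z).
Proof. by move=> PP'; elim: xs z => [|x xs IH] /= z; [exact: PP'|case; split; exact: IH]. Qed.

Lemma cmap_eq_in xs x L L' (z : cochain V xs) :
  (forall v, x *: L v = L' (x *: v)) -> x *: cmap L z = cmap L' (x *: z).
Proof. by move=> LL'; elim: xs z => [|y ys IH] z /=; [exact: LL'|rewrite -!IH]. Qed.

Lemma cmap_homotopy xs L L' L1 L2 (z : cochain V xs) :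
  (forall v, v - L (L' v) = L1 (L2 v)) -> z - cmap L (cmap L' z) = cmap L1 (cmap L2 z).
Proof.
move=> LE; elim: xs z => [|x xs IH] z /=; first exact: LE.
by rewrite -!IH; case: z.
Qed.

Lemma cmap_scale xs x (z : cochain V xs) : cmap ( *:%R x) z = x *: z.
Proof. by elim: xs z => [|y ys IH] z //=; rewrite !IH. Qed.

(** A map that changes exponents of x does not commute with x; a chain map only requires that x
    intertwine [L0] on its source with [L1] on its target. *)
Definition cone_map x xs L0 L1 (z : cochain V (x :: xs)) : cochain V (x :: xs) :=
  (cmap L0 z.1, cmap L1 z.2).

Lemma cone_map_kdiff x xs L0 L1 (z : cochain V (x :: xs)) :
  {morph L0 : u v / u - v} -> {morph L1 : u v / u - v} ->
  (forall y v, y \in xs -> L0 (y *: v) = y *: L0 v) ->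
  (forall y v, y \in xs -> L1 (y *: v) = y *: L1 v) ->
  (forall v, x *: L0 v = L1 (x *: v)) ->
  cone_map L0 L1 (kdiff z) = kdiff (cone_map L0 L1 z).
Proof.
move=> L0B L1B L0Z L1Z xL; rewrite /cone_map /= cmapB // !cmap_kdiff //.
by rewrite (cmap_eq_in _ xL).
Qed.

(* F and G are chain maps between the Koszul complexes of P' / Q' and P / Q, given on
   the two halves of the cone of x; x^-1, as far as it exists, is the homotopy H. *)
Lemma acyclic_below_cone x xs r P Q P' Q' F0 F1 G0 G1 H :
  is_submod P -> is_submod Q ->
  {morph F0 : u v / u - v} -> {morph F1 : u v / u - v} ->
  {morph G0 : u v / u - v} -> {morph G1 : u v / u - v} ->
  {morph H : u v / u - v} ->
  (forall y v, y \in xs -> F0 (y *: v) = y *: F0 v) ->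
  (forall y v, y \in xs -> F1 (y *: v) = y *: F1 v) ->
  (forall y v, y \in xs -> G0 (y *: v) = y *: G0 v) ->
  (forall y v, y \in xs -> G1 (y *: v) = y *: G1 v) ->
  (forall y v, y \in xs -> H (y *: v) = y *: H v) ->
  (forall v, x *: F0 v = F1 (x *: v)) -> (forall v, x *: G0 v = G1 (x *: v)) ->
  (forall v, v - F0 (G0 v) = H (x *: v)) -> (forall v, v - F1 (G1 v) = x *: H v) ->
  (forall v, P' v -> P (F0 v) /\ P (F1 v)) -> (forall v, Q' v -> Q (F0 v) /\ Q (F1 v)) ->
  (forall v, P v -> P' (G0 v) /\ P' (G1 v)) -> (forall v, Q v -> Q' (G0 v) /\ Q' (G1 v)) ->
  (forall v, P v -> P (H v)) -> (forall v, Q v -> Q (H v)) ->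
  acyclic_below (x :: xs) r P' Q' -> acyclic_below (x :: xs) r P Q.
Proof.
move=> sP sQ F0B F1B G0B G1B HB F0Z F1Z G0Z G1Z HZ xF xG H0 H1 FP FQ GP GQ HP HQ.
pose h (z : cochain V (x :: xs)) : cochain V (x :: xs) := (cmap H z.2, 0).
apply: (@acyclic_below_homotopy (x :: xs) r P Q P' Q'
  (@cone_map x xs F0 F1) (@cone_map x xs G0 G1) h) => //.
- by move=> z w; rewrite /cone_map /= !cmapB.
- by move=> z; apply: cone_map_kdiff.
- by move=> z; apply: cone_map_kdiff.
- have G00 : G0 0 = 0 by have := G0B 0 0; rewrite !subrr.
  have G10 : G1 0 = 0 by have := G1B 0 0; rewrite !subrr.
  by move=> z; rewrite /cone_map /= !cmap_trunc.
- by move=> z [za zb]; split; [apply: cmap_in za|apply: cmap_in zb] => v /FP[].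
- by move=> z [za zb]; split; [apply: cmap_in za|apply: cmap_in zb] => v /FQ[].
- by move=> z [za zb]; split; [apply: cmap_in za|apply: cmap_in zb] => v /GP[].
- by move=> z [za zb]; split; [apply: cmap_in za|apply: cmap_in zb] => v /GQ[].
- move=> z [_ zb]; split; first exact: cmap_in zb.
  by case: (in_all_submod xs sP).
- move=> z [_ zb]; split; first exact: cmap_in zb.
  by case: (in_all_submod xs sQ).
move=> z; apply: (cochain_consP (x := x)) => /=.
  rewrite (cmap_homotopy _ H0) cmapB // cmap_kdiff // cmap_scale addrC.
  by rewrite subrK.
by rewrite (cmap_homotopy _ H1) kdiff0 subr0 addr0 cmap_scale.
Qed.
End Transfer.

(** * Noetherian modules and regular sequences *)

Lemma choose_sequence (T : Type) (E : seq T -> T -> Prop) :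
  (forall s, exists x, E s x) -> exists a : nat -> T, forall m, E (mkseq a m) (a m).
Proof.
move=> /choice[f fE]; pose g m := iter m (fun s => rcons s (f s)) [::].
exists (f \o g) => m; suff -> : mkseq (f \o g) m = g m by exact: fE.
by elim: m => //= m IH; rewrite mkseqS IH.
Qed.

(** The ascending chain condition, in a form that applies directly to sequences obtained by
    choice. *)
Definition noetherian (R : comNzRingType) (V : lmodType R) :=
  forall a : nat -> V, exists m, span (mkseq a m) (a m).

(** Otherwise elements of [T] outside the span of the earlier ones could be chosen forever. *)
Lemma noetherian_span (R : comNzRingType) (V : lmodType R) (T : V -> Prop) :
  noetherian V ->
  exists s : seq V, (forall v, v \in s -> T v) /\ forall v, T v -> span s v.
Proof.
move=> nV; apply: contrapT => no.
pose E s x := (forall v : V, v \in s -> T v) -> T x /\ ~ span s x.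
have [s|a aE] := @choose_sequence V E.
  apply: contrapT => nE; apply: no; exists s; split=> v.
    by move=> vs; apply: contrapT => nT; apply: nE; exists 0 => /(_ v vs).
  by move=> Tv; apply: contrapT => ns; apply: nE; exists v.
have Ta m : T (a m).
  have [k] := ubnP m; elim: k m => // k IH m lt_mk.
  apply: (proj1 (aE m _)) => v /mapP[i]; rewrite mem_iota add0n => lt_im ->.
  by apply: IH; apply: leq_trans lt_im _.
have [m] := nV a; apply: (proj2 (aE m _)) => v /mapP[i _ ->]; exact: Ta.
Qed.

(** Otherwise the ideals [F (g m)] grow strictly forever, and the elements gained at each stage form
    a sequence that contradicts [nR]. *)
Lemma noetherian_maximal (R : comNzRingType) (X : Type) (F : X -> R -> Prop)
    (D : X -> Prop) x :
  noetherian R^o -> (forall x, D x -> is_submod (F x : R^o -> Prop)) -> D x ->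
  exists y, [/\ D y, forall r, F x r -> F y r
    & forall z, D z -> (forall r, F y r -> F z r) -> forall r, F z r -> F y r].
Proof.
move=> nR sF Dx; apply: contrapT => no.
pose up y := D y /\ forall r, F x r -> F y r.
have [y|f fE] := @choice X (X * R) (fun y t => up y ->
    [/\ D t.1, forall r, F y r -> F t.1 r, F t.1 t.2 & ~ F y t.2]).
  have [[Dy xy]|nu] := pselect (up y); last by exists (x, 0) => /nu.
  apply: contrapT => ny; apply: no; exists y; split=> // z Dz yz r zr.
  by apply: contrapT => nyr; apply: ny; exists (z, r).
pose g m := iter m (fun y => (f y).1) x.
have gup m : up (g m).
  elim: m => [|m IH] /=; first by split.
  by have [Dz gz _ _] := fE _ IH; split=> // r /(proj2 IH) /gz.
have gle m k : (m <= k)%N -> forall r, F (g m) r -> F (g k) r.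
  move/subnK <-; elim: (k - m)%N => // d IH r /IH /=.
  by have [_ + _ _] := fE _ (gup (d + m)%N); apply.
have [m] := nR (fun m => (f (g m)).2).
have [_ _ _ nFm] := fE _ (gup m); move=> sp; apply: nFm.
apply: span_min sp; first exact: sF (proj1 (gup m)).
move=> y /mapP[i]; rewrite mem_iota add0n => lt_im ->.
by apply: (gle i.+1) => //=; have [] := fE _ (gup i).
Qed.

Definition prime_set (R : comNzRingType) (F : R -> Prop) :=
  ~ F 1 /\ forall a b, F (a * b) -> F a \/ F b.

Section PrimeAvoidance.
Variables (R : comNzRingType) (X : eqType) (F : X -> R -> Prop).

Lemma prime_inter (p : R -> Prop) (s : seq X) : prime_set p ->
  (forall y, y \in s -> is_submod (F y : R^o -> Prop)) ->
  (forall y, y \in s -> exists2 a, F y a & ~ p a) ->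
  exists2 g, ~ p g & forall y, y \in s -> F y g.
Proof.
move=> [p1 pM]; elim: s => [|y s IH] sF sp; first by exists 1.
have [z zs|z zs|g ng gs] := IH.
- by apply: sF; rewrite inE zs orbT.
- by apply: sp; rewrite inE zs orbT.
have [a ya na] := sp y (mem_head _ _).
exists (a * g) => [/pM[]//|z]; rewrite inE => /orP[/eqP ->|zs].
  by rewrite mulrC; apply: (smodZ (V := R^o)) => //; apply: sF; rewrite mem_head.
apply: (smodZ (V := R^o)); last exact: gs.
by apply: sF; rewrite inE zs orbT.
Qed.

(** If f avoids the primes of [s] but lies in [F x], then f + g y0 avoids them all, for [y0] in m
    outside [F x] and g outside [F x] in all the others. Such a g exists: an inclusion of [F y] in
    [F x] would be an equality, but f lies in [F x] only. *)
Lemma prime_avoidance (m : R -> Prop) (s : seq X) : is_submod (m : R^o -> Prop) ->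
  (forall y, y \in s -> is_submod (F y : R^o -> Prop)) ->
  (forall y, y \in s -> prime_set (F y)) ->
  (forall y z, y \in s -> z \in s ->
     (forall r, F y r -> F z r) -> forall r, F z r -> F y r) ->
  (forall y, y \in s -> exists2 r, m r & ~ F y r) ->
  exists2 f, m f & forall y, y \in s -> ~ F y f.
Proof.
move=> sm; elim: s => [|x s IH] sF pF aF mF; first by exists 0 => //; case: sm.
have sxs y : y \in s -> y \in x :: s by rewrite inE orbC => ->.
have [|||| f mf fs] := IH.
- by move=> y /sxs; apply: sF.
- by move=> y /sxs; apply: pF.
- by move=> y z /sxs ? /sxs; apply: aF.
- by move=> y /sxs; apply: mF.
have xxs := mem_head x s.
have [xf|nxf] := pselect (F x f); last first.
  by exists f => // y; rewrite inE => /orP[/eqP->|/fs].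
have [y0 my0 nxy0] := mF x xxs.
have [y /sxs/sF //|y ys|g nxg gs] := @prime_inter (F x) s (pF x xxs).
  apply: contrapT => nya; apply: (fs y ys); apply: (aF y x) => //; first exact: sxs.
  by move=> r yr; apply: contrapT => nxr; apply: nya; exists r.
exists (f + g * y0).
  by apply: (smodD sm) => //; apply: (smodZ (V := R^o)).
move=> y; rewrite inE => /orP[/eqP->|ys] Fy.
  have: F x (g * y0).
    by rewrite -[_ * _](addKr f); apply: (smodD (sF x xxs)) => //; apply: (smodN (sF x xxs)).
  by case/(proj2 (pF x xxs)).
apply: (fs y ys); have sy := sF y (sxs y ys).
rewrite -[f](addrK (g * y0)); apply: (smodB sy) => //.
by rewrite mulrC; apply: (smodZ (V := R^o)) => //; apply: gs.
Qed.
End PrimeAvoidance.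

Section Regular.
Variables (R : comNzRingType) (V : lmodType R).
Hypotheses (nR : noetherian R^o) (nV : noetherian V).
Implicit Types P Q : V -> Prop.

(* Annihilators maximal among those of the elements of P outside Q are prime, and as V
   is noetherian each of them is one of finitely many; none contains m, so prime
   avoidance applies. *)
Lemma exists_nonzerodivisor (m : R -> Prop) P Q :
  is_submod (m : R^o -> Prop) -> is_submod P -> is_submod Q ->
  (forall v, P v -> (forall f, m f -> Q (f *: v)) -> Q v) ->
  exists2 f, m f & nonzerodivisor P Q f.
Proof.
move=> sm sP sQ socle.
pose ann v r := Q (r *: v); pose D v := P v /\ ~ Q v.
have sann v : is_submod (ann v : R^o -> Prop).
  split=> [|a x y Qx Qy]; rewrite /ann; first by rewrite scale0r; case: sQ.
  by rewrite scalerDl -scalerA; apply sQ.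
pose T v := D v /\ forall u, D u -> (forall r, ann v r -> ann u r) ->
  forall r, ann u r -> ann v r.
have prT v : T v -> prime_set (ann v).
  move=> [[Pv nQv] mv]; split; first by rewrite /ann scale1r.
  move=> a b Qab; have [|nb] := pselect (ann v b); [by right|left].
  apply: (mv (b *: v)) => [|r vr|].
  - by split=> //; apply: smodZ.
  - by rewrite /ann scalerA mulrC -scalerA; apply: smodZ.
  - by rewrite /ann scalerA.
have [s [sT Ts]] := @noetherian_span _ _ T nV.
have [v _|v /sT|y z /sT[_ my] /sT[Dz _]|v /sT[[Pv nQv] _]|f mf fs] :=
  @prime_avoidance _ _ ann m s sm.
- exact: sann.
- exact: prT.
- exact: my.
- apply: contrapT => nm; apply: nQv; apply: socle => // f mf.
  by apply: contrapT => nQf; apply: nm; exists f.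
exists f => // u Pu Qfu; apply: contrapT => nQu.
have [w [Dw uw mw]] :=
  noetherian_maximal (F := ann) (D := D) nR (fun x _ => sann x) (conj Pu nQu).
have Tw : T w by [].
(* If the prime [ann w] contained no [ann v] with v in [s], some g outside [ann w] would send all of
   [s] into Q, hence also w, which lies in the span of [s]. *)
have [v vs vw] : exists2 v, v \in s & forall r, ann v r -> ann w r.
  apply: contrapT => nv.
  have [||g ng gs] := @prime_inter _ _ ann (ann w) s (prT w Tw); first by [].
    move=> y ys; apply: contrapT => ny; apply: nv; exists y => // r yr.
    by apply: contrapT => nwr; apply: ny; exists r.
  apply: ng; apply: (@span_min _ _ s (fun v => Q (g *: v)) w) (Ts w Tw).
    split=> [|a x y Qx Qy]; first by rewrite scaler0; case: sQ.
    by rewrite scalerDr scalerA mulrC -scalerA; apply sQ.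
  by move=> x /gs.
by apply: (fs v vs); have [_ mv] := sT v vs; apply: (mv w) => //; apply: uw.
Qed.

(** Depth sensitivity of the Koszul complex. Vanishing in degree 0 says that nothing outside Q is
    killed by [xs], which yields a nonzerodivisor in the ideal of [xs]; dividing by it lowers r by
    one. *)
Lemma acyclic_below_regular (xs : seq R) r P Q : is_submod P -> is_submod Q ->
  acyclic_below xs r P Q <->
  exists fs, [/\ size fs = r, forall f, f \in fs -> span (V := R^o) xs f
    & regular_on P Q fs].
Proof.
move=> sP; elim: r Q => [|r IH] Q sQ.
  split=> _; last exact: acyclic_below0.
  by exists [::].
split=> [acyc|[[|f fs] [//= [sz] fxs [fPQ reg]]]].
  have [|v Pv mv|f xsf fPQ] := @exists_nonzerodivisor (span (V := R^o) xs) P Q _ sP sQ.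
  - exact: (@span_submod _ R^o).
  - apply: (acyclic_below_socle sP sQ acyc Pv) => x xxs; apply: mv.
    exact: (@mem_span _ R^o).
  have sF := sum_mul_submod f sP sQ.
  move: acyc; rewrite (acyclic_below_sum_mul _ sP sQ xsf fPQ) => /(IH _ sF).
  case=> fs [sz fsx reg]; exists (f :: fs); split=> //=; first by rewrite sz.
  by move=> g; rewrite inE => /orP[/eqP->|/fsx].
have xsf : span (V := R^o) xs f by apply: fxs; rewrite mem_head.
rewrite (acyclic_below_sum_mul _ sP sQ xsf fPQ).
apply/(IH _ (sum_mul_submod f sP sQ)); exists fs; split=> // g gfs.
by apply: fxs; rewrite inE gfs orbT.
Qed.
End Regular.

(** Each chosen index is one where f attains its least value on a tail, and the next tail starts
    right after it. *)
Lemma monotone_subsequence (f : nat -> nat) : exists phi : nat -> nat,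
  {homo phi : a b / (a < b)%N} /\ {homo f \o phi : a b / (a <= b)%N}.
Proof.
have [N|k kP] := @choice nat nat (fun N k => (N <= k)%N /\ forall l, (N <= l)%N -> (f k <= f l)%N).
  suff H d k : (N <= k)%N -> (f k < d)%N ->
    exists k, (N <= k)%N /\ forall l, (N <= l)%N -> (f k <= f l)%N by exact: (H (f N).+1 N).
  elim: d k => // d IH k Nk lt_fd.
  have [[l Nl lt_l]|no] := pselect (exists2 l, (N <= l)%N & (f l < f k)%N).
    exact: (IH l Nl (leq_trans lt_l lt_fd)).
  by exists k; split=> // l Nl; rewrite leqNgt; apply/negP => lt; apply: no; exists l.
pose phi m := iter m (fun p => k p.+1) (k 0).
have ltS m : (phi m < phi m.+1)%N by have [] := kP (phi m).+1.
exists phi; split; first exact: homo_ltn ltn_trans ltS.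
apply: (homo_leq (@leqnn)); first exact: leq_trans.
move=> m /=; have lt := ltS m; case: m lt => [|m] lt /=.
  by have [_ +] := kP 0; apply.
have [le_k +] := kP (phi m).+1; apply.
by apply: leq_trans le_k _; apply: ltnW; exact: lt.
Qed.

(** Passing to subsequences makes the exponents nondecreasing, one variable after another. *)
Lemma dickson (n : nat) (u : nat -> 'X_{1..n}) :
  exists i j, (i < j)%N /\ (u i <= u j)%MM.
Proof.
suff [phi [phi_incr uphi]] : exists phi : nat -> nat,
    {homo phi : a b / (a < b)%N} /\
    forall i, i \in enum 'I_n -> {homo (fun a => u (phi a) i) : a b / (a <= b)%N}.
  exists (phi 0), (phi 1); split; first exact: phi_incr.
  by apply/mnm_lepP => i; apply: uphi; rewrite ?mem_enum.
elim: (enum 'I_n) => [|i s [phi [phi_incr uphi]]]; first by exists id; split.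
have [psi [psi_incr upsi]] := monotone_subsequence (fun a => u (phi a) i).
exists (phi \o psi); split=> [a b ab|j]; first exact/phi_incr/psi_incr.
rewrite inE => /orP[/eqP -> a b ab|js a b ab] /=; first exact: (upsi a b ab).
by apply: uphi => //; exact: (ltnW_homo psi_incr).
Qed.

Section Noetherian.
Variables (K : fieldType) (n : nat).
Notation S := {mpoly K[n]}.

(* Otherwise choose successively elements outside the span of the previous ones, with
   least leading monomial: by Dickson's lemma one of them can be reduced further. *)
Lemma mpoly_noetherian : noetherian S^o.
Proof.
move=> a; apply: contrapT => no_m.
pose L (v : S^o) := exists k, span (mkseq a k) v.
have sub_le k l : (k <= l)%N -> forall v, span (mkseq a k) v -> span (mkseq a l) v.
  move=> kl v; apply: span_min; first exact: span_submod.
  move=> y /mapP[i]; rewrite mem_iota add0n => lt_ik ->.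
  apply: mem_span; apply/map_f; rewrite mem_iota add0n /=; exact: leq_trans kl.
have sL : is_submod L.
  split=> [|c u v [k ku] [l lv]]; first by exists 0%N.
  exists (maxn k l); apply: (proj2 (span_submod _)).
    by apply: sub_le ku; exact: leq_maxl.
  by apply: sub_le lv; exact: leq_maxr.
pose E (s : seq S^o) x := (forall v, v \in s -> L v) ->
  [/\ L x, ~ span s x
    & forall y, L y -> ~ span s y -> ~ (mlead (y : S) < mlead (x : S))%O].
have [s|f fE] := @choose_sequence S^o E.
  have [sL'|nsL] := pselect (forall v, v \in s -> L v); last by exists 0 => /nsL.
  have [k sk] : exists k, forall v, v \in s -> span (mkseq a k) v.
    elim: s sL' => [|v s IH] sL'; first by exists 0%N.
    have [z zs|k ks] := IH; first by apply: sL'; rewrite inE zs orbT.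
    have [l lv] := sL' v (mem_head _ _); exists (maxn k l) => z.
    rewrite inE => /orP[/eqP ->|zs]; first by apply: sub_le lv; exact: leq_maxr.
    by apply: sub_le (ks z zs); exact: leq_maxl.
  have Lk : L (a k).
    exists k.+1; apply: mem_span; apply/map_f; rewrite mem_iota add0n /=; exact: leqnn.
  have nk : ~ span s (a k).
    move=> sa; apply: no_m; exists k; apply: span_min sa => //; exact: span_submod.
  move: {2}(mlead (a k : S)) (erefl (mlead (a k : S))) => m.
  move: (a k) Lk nk; elim/(@ltmwf n): m => m IH x Lx nx Em.
  have [[y [Ly ny yx]]|no_y] := pselect (exists y : S^o,
      [/\ L y, ~ span s y & (mlead (y : S) < mlead (x : S))%O]).
    by apply: (IH (mlead (y : S)) _ y Ly ny) => //; rewrite -Em.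
  by exists x => _; split=> // y Ly ny yx; apply: no_y; exists y.
have Lf m : L (f m).
  have [k] := ubnP m; elim: k m => // k IH m lt_mk.
  have [v /mapP[i]|//] := fE m; rewrite mem_iota add0n => lt_im ->.
  by apply: IH; apply: leq_trans lt_im _.
have fE' m : [/\ L (f m), ~ span (mkseq f m) (f m)
    & forall y, L y -> ~ span (mkseq f m) y -> ~ (mlead (y : S) < mlead (f m : S))%O].
  by apply: fE => v /mapP[i _ ->].
have [i [j [lt_ij le_ij]]] := dickson (fun m => mlead (f m : S)).
have [_ nfj minj] := fE' j.
have fneq0 m : (f m : S) != 0.
  have [_ nf _] := fE' m; apply/eqP => f0; apply: nf.
  have -> : f m = 0 by exact: f0.
  by case: (span_submod (mkseq f m)).
(* [c * f i] has the leading term of [f j]; subtracting it stays outside the span but lowers the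
   leading monomial, against the minimality of [f j]. *)
pose c : S := (mleadc (f j : S) / mleadc (f i : S)) *: 'X_[mlead (f j : S) - mlead (f i : S)].
pose y : S := (f j : S) - c * (f i : S).
have fi : span (mkseq f j) (f i).
  by apply: mem_span; apply/map_f; rewrite mem_iota add0n.
have ny : ~ span (mkseq f j) (y : S^o).
  move=> sy; apply: nfj; have -> : f j = (y : S^o) + (c : S) *: f i by rewrite subrK.
  by apply: (smodD (span_submod _)) => //; apply: smodZ => //; exact: span_submod.
have Ly : L (y : S^o) by apply: (smodB sL) => //; apply: (smodZ _ sL).
apply: (minj _ Ly ny).
have y0 : y != 0.
  by apply/eqP => y0; apply: ny; rewrite y0; case: (span_submod (mkseq f j)).
have ci : mlead (c * (f i : S)) = mlead (f j : S).
  rewrite /c -scalerAl mleadZ ?mulf_neq0 ?invr_eq0 ?mleadc_eq0 //.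
  rewrite mleadM; [by rewrite mleadXm submK|by rewrite -msupp_eq0 msuppX|exact: fneq0].
have coefE : (c * (f i : S))@_(mlead (f j : S)) = mleadc (f j : S).
  have := mcoeffMX (f i : S) (mlead (f j : S) - mlead (f i : S))%MM (mlead (f i : S)).
  rewrite submK // => fiE; rewrite /c -scalerAl mcoeffZ ['X_[_] * _]mulrC fiE.
  by rewrite divfK // mleadc_eq0; exact: fneq0.
rewrite lt_neqAle; apply/andP; split; last first.
  by have := mleadB_le (f j : S) (c * (f i : S)); rewrite ci joinxx.
apply/eqP => ly; have := mlead_supp y0.
by rewrite mcoeff_msupp ly mcoeffB coefE subrr eqxx.
Qed.
End Noetherian.

(** * Depth of stretched factors *)

Section MonomialMaps.
Variables (K : fieldType) (n : nat).
Notation S := {mpoly K[n]}.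
Implicit Types (I J : ideal K n) (m : 'X_{1..n}) (j : 'I_n) (g : nat -> option nat).

Lemma ideal_mull I (a p : S) : (p : S^o) \in I -> (a * p : S^o) \in I.
Proof. by move=> Ip; exact: (rpredZ a Ip). Qed.

Lemma mem_monomial_ideal I (p : S^o) : monomial_ideal I ->
  (p \in I) <-> forall m, m \in msupp (p : S) -> ('X_[m] : S^o) \in I.
Proof.
case=> A IA; split=> [|pI]; last first.
  rewrite [p](mpolyE (p : S)) big_seq; apply: rpred_sum => m /pI Im.
  by rewrite -mul_mpolyC; apply: ideal_mull.
rewrite IA => /asboolP[s [sA ->]] m /msupp_sum_le /flattenP[t].
case/mapP=> x; rewrite filter_predT => /sA Ax -> /msuppM_le.
rewrite msuppX => /allpairsP[[a b] /= [_]]; rewrite inE => /eqP -> ->.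
by rewrite IA; apply/monomial_spanP; exists x.2 => //; exact: lem_addl.
Qed.

Definition set_exp j (k : nat) m : 'X_{1..n} := [multinom if i == j then k else m i | i < n].

Definition lin_ext (G : 'X_{1..n} -> S) (p : S) : S := \sum_(m <- msupp p) p@_m *: G m.

(** An index set common to several polynomials, so that linearity can be checked termwise. *)
Lemma lin_ext_wide G p k : (msize p <= k)%N ->
  lin_ext G p = \sum_(m : 'X_{1..n < k}) p@_m *: G m.
Proof.
move=> lt_pk; pose I : subFinType _ := 'X_{1..n < k}.
rewrite /lin_ext (big_mksub I) //=; first last.
- by move=> x /msize_mdeg_lt /leq_trans; apply.
- exact: msupp_uniq.
by rewrite big_rmcond //= => i /memN_msupp_eq0 ->; rewrite scale0r.
Qed.

Fact lin_ext_is_linear G : linear (lin_ext G).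
Proof.
move=> c p q; pose k := maxn (msize (c *: p + q)) (maxn (msize p) (msize q)).
rewrite !(@lin_ext_wide _ _ k) ?leq_max ?leqnn ?orbT //.
rewrite scaler_sumr -big_split /=; apply: eq_bigr => m _.
by rewrite mcoeffD mcoeffZ scalerDl scalerA.
Qed.
HB.instance Definition _ G := GRing.isLinear.Build K S S *:%R (lin_ext G) (lin_ext_is_linear G).

Lemma lin_extX G m : lin_ext G 'X_[m] = G m.
Proof. by rewrite /lin_ext msuppX big_seq1 mcoeffX eqxx scale1r. Qed.

(** Linear over the variables other than x_j; the value [None] kills the monomial. *)
Definition mono_map j g : S -> S :=
  lin_ext (fun m => if g (m j) is Some k then 'X_[set_exp j k m] else 0).
HB.instance Definition _ j g := GRing.Linear.on (mono_map j g).

Lemma mono_mapX j g m :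
  mono_map j g 'X_[m] = if g (m j) is Some k then 'X_[set_exp j k m] else 0.
Proof. exact: lin_extX. Qed.

Lemma mono_map_in j g I J (p : S^o) : monomial_ideal I ->
  (forall m k, ('X_[m] : S^o) \in I -> g (m j) = Some k ->
     ('X_[set_exp j k m] : S^o) \in J) ->
  p \in I -> (mono_map j g p : S^o) \in J.
Proof.
move=> mI IJ /(mem_monomial_ideal _ mI) pI; rewrite /mono_map /lin_ext big_seq.
apply: (rpred_sum (S := J)) => m /pI Im; rewrite -mul_mpolyC.
apply: ideal_mull.
by case E: (g (m j)) => [k|]; [exact: IJ Im E|exact: rpred0].
Qed.

Lemma mono_map_mulX j g i (p : S) : i != j -> mono_map j g ('X_i * p) = 'X_i * mono_map j g p.
Proof.
move=> ne; elim/mpolyind: p => [|c m p _ _ IH]; first by rewrite mulr0 linear0 mulr0.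
rewrite mulrDr -scalerAr !linearP /= mulrDr IH -scalerAr; congr (_ *: _ + _).
rewrite -mpolyXD !mono_mapX mnmDE mnm1E (negPf ne) add0n.
case: (g (m j)) => [k|]; last by rewrite mulr0.
rewrite -mpolyXD; congr 'X_[_]; apply/mnmP => l; rewrite !mnmE.
by case: (eqVneq l j) => [->|//]; rewrite (negPf ne).
Qed.

Lemma mono_map_mulXj j g g' (p : S) : (forall e, g' e.+1 = omap succn (g e)) ->
  'X_j * mono_map j g p = mono_map j g' ('X_j * p).
Proof.
move=> gg'; elim/mpolyind: p => [|c m p _ _ IH]; first by rewrite !(linear0, mulr0).
rewrite !mulrDr -scalerAr !linearP /= mulrDr IH -scalerAr; congr (_ *: _ + _).
rewrite -mpolyXD !mono_mapX mnmDE mnm1E eqxx add1n gg'.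
case: (g (m j)) => [k|] /=; last by rewrite mulr0.
rewrite -mpolyXD; congr 'X_[_]; apply/mnmP => l; rewrite !mnmE.
by case: (l =P j) => [->|]; rewrite ?eqxx.
Qed.
End MonomialMaps.

(** * Stretchings of the exponents of one variable *)

Record stretching (c : nat -> nat) : Prop := Stretching {
  stretch0 : c 0 = 0%N;
  stretchS : forall e, c e.+1 = c e \/ c e.+1 = (c e).+1;
  stretch_onto : forall k, exists e, c e == k
}.

Section Stretching.
Variables (c : nat -> nat) (cP : stretching c).

Lemma stretch_homo : {homo c : a b / (a <= b)%N}.
Proof.
apply: (homo_leq (@leqnn)); first exact: leq_trans.
by move=> e; case: (stretchS cP e) => ->.
Qed.

Definition fiber_min k := ex_minn (stretch_onto cP k).

Lemma fiber_minK : cancel fiber_min c.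
Proof. by move=> k; rewrite /fiber_min; case: ex_minnP => e /eqP. Qed.

Lemma fiber_min_min e : (fiber_min (c e) <= e)%N.
Proof. by rewrite /fiber_min; case: ex_minnP => l _; apply. Qed.

(** [fiber_min] is the lower adjoint of c: starting from 0 with steps of at most one, c takes every
    value up to [c e] at or before e. *)
Lemma fiber_min_le e k : (fiber_min k <= e)%N = (k <= c e)%N.
Proof.
apply/idP/idP => [/stretch_homo|le_k]; first by rewrite fiber_minK.
suff [e' le_e <-] : exists2 e', (e' <= e)%N & c e' = k.
  exact: leq_trans (fiber_min_min e') le_e.
elim: e le_k => [|e IH] le_k.
  by exists 0; rewrite // stretch0 //; move: le_k; rewrite stretch0 // leqn0 => /eqP.
have [lt_k|] := ltnP (c e) k; last by case/IH => e' /leqW ? <-; exists e'.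
exists e.+1 => //; apply/eqP; rewrite eqn_leq le_k andbT.
by case: (stretchS cP e) le_k => -> //; rewrite leqNgt lt_k.
Qed.

Lemma fiber_min_homo : {homo fiber_min : a b / (a <= b)%N}.
Proof. by move=> a b ab; rewrite fiber_min_le fiber_minK. Qed.

Lemma fiber_min0 : fiber_min 0 = 0%N.
Proof. by apply/eqP; rewrite -leqn0 fiber_min_le. Qed.

Lemma fiber_min_jump e : c e.+1 = (c e).+1 -> fiber_min (c e).+1 = e.+1.
Proof.
by move=> cE; apply/eqP; rewrite eqn_leq fiber_min_le cE leqnn /= ltnNge fiber_min_le ltnn.
Qed.

(** This e is the last exponent with value k, just before a jump. So [stretch_source] selects the
    largest element of each fiber, [stretch_target] the smallest. *)
Lemma fiber_minS k : exists2 e, fiber_min k.+1 = e.+1 & c e = k.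
Proof.
case E: (fiber_min k.+1) => [|e]; first by have := fiber_minK k.+1; rewrite E stretch0.
exists e => //; apply/eqP; rewrite eqn_leq -ltnS ltnNge -fiber_min_le E ltnn /=.
by have := fiber_minK k.+1; rewrite E; case: (stretchS cP e) => -> // [->].
Qed.

(* In the strand of degree a of the Koszul complex, x_j maps exponent a - 1 to a.
   c identifies the strands where c jumps with those downstairs: the two unstretch
   maps do so on the source and on the target of x_j, the stretch maps are their
   sections. On the other strands x_j is invertible, with inverse unshift. *)
Definition stretch_source k := Some (fiber_min k.+1).-1.
Definition stretch_target k := Some (fiber_min k).
Definition unstretch_source e := if c e.+1 == c e then None else Some (c e).
Definition unstretch_target e :=
  if e is e'.+1 then omap succn (unstretch_source e') else Some 0%N.
Definition unshift e :=
  if e is e'.+1 then if c e'.+1 == c e' then Some e' else None else None.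
End Stretching.

Section StretchedIdeals.
Variables (K : fieldType) (n : nat) (j : 'I_n).
Notation S := {mpoly K[n]}.
Implicit Types (I J : ideal K n) (m : 'X_{1..n}).

Definition stretched (c : nat -> nat) I I' := forall m,
  (('X_[m] : S^o) \in I) = (('X_[set_exp j (c (m j)) m] : S^o) \in I').

Lemma set_expE k m : set_exp j k m j = k.
Proof. by rewrite mnmE eqxx. Qed.

Lemma set_exp_set k l m : set_exp j k (set_exp j l m) = set_exp j k m.
Proof. by apply/mnmP => i; rewrite !mnmE; case: eqP. Qed.

Lemma set_exp_id m : set_exp j (m j) m = m.
Proof. by apply/mnmP => i; rewrite !mnmE; case: eqP => [->|]. Qed.

Lemma set_exp_mulX k m : set_exp j k.+1 m = (U_(j) + set_exp j k m)%MM.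
Proof.
by apply/mnmP => i; rewrite !mnmE [j == i]eq_sym; case: eqP.
Qed.

Lemma ideal_submod I : is_submod (fun p : S^o => p \in I).
Proof.
split=> [|a u v Iu Iv]; first exact: rpred0.
by apply: rpredD => //; apply: rpredZ.
Qed.

Section Transfer.
Variables (c : nat -> nat) (cP : stretching c) (I J I' J' : ideal K n).
Hypotheses (mI : monomial_ideal I) (mJ : monomial_ideal J).
Hypotheses (mI' : monomial_ideal I') (mJ' : monomial_ideal J').
Hypotheses (cI : stretched c I I') (cJ : stretched c J J').
Variables (xs : seq S).
Hypothesis xsX : forall x, x \in xs -> exists2 i, i != j & x = 'X_i.

(** F leads from I' / J' to I / J and G back; index 0 is for the source of x_j, index 1 for its
    target. G F is the identity, and H is the homotopy between F G and the identity. *)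
Let F0 : S^o -> S^o := mono_map j (stretch_source cP).
Let F1 : S^o -> S^o := mono_map j (stretch_target cP).
Let G0 : S^o -> S^o := mono_map j (unstretch_source c).
Let G1 : S^o -> S^o := mono_map j (unstretch_target c).
Let H : S^o -> S^o := mono_map j (unshift c).

Let comm g y (v : S^o) : y \in xs ->
  (mono_map j g (y *: v) : S^o) = y *: (mono_map j g v : S^o).
Proof. by case/xsX => i ne ->; exact: mono_map_mulX. Qed.

Let morphB g : {morph (mono_map j g : S^o -> S^o) : u v / u - v}.
Proof. by move=> u v; exact: raddfB. Qed.

Let F_mul v : 'X_j *: F0 v = F1 ('X_j *: v).
Proof.
apply: mono_map_mulXj => k; rewrite /stretch_target /=.
by case: (fiber_minS cP k) => e ->.
Qed.

Let G_mul v : 'X_j *: G0 v = G1 ('X_j *: v).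
Proof. exact: mono_map_mulXj. Qed.

(** If c is constant from e to e + 1, then [G0] kills the monomial and H undoes the multiplication
    by x_j. If c jumps there, [F0] after [G0] fixes the monomial and H kills its product with
    x_j. *)
Let FG0 v : v - F0 (G0 v) = H ('X_j *: v).
Proof.
suff E (p : S) : p - mono_map j (stretch_source cP) (mono_map j (unstretch_source c) p) =
    mono_map j (unshift c) ('X_j * p) by exact: E.
elim/mpolyind: p => [|a m p _ _ IH]; first by rewrite mulr0 !linear0 addr0.
rewrite mulrDr -scalerAr !linearP /= -IH addrACA -scalerDr; congr (_ *: _ + _).
rewrite -mpolyXD !mono_mapX mnmDE mnm1E eqxx add1n /=.
rewrite /unstretch_source; case: eqP => [_|jump].
  rewrite linear0 subr0; congr 'X_[_].
  by apply/mnmP => i; rewrite !mnmE [j == i]eq_sym; case: eqP => [->|].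
rewrite mono_mapX set_expE /=; case: (stretchS cP (m j)) => // cE.
by rewrite (fiber_min_jump cP cE) /= set_exp_set set_exp_id subrr.
Qed.

Let FG1 v : v - F1 (G1 v) = 'X_j *: H v.
Proof.
suff E (p : S) : p - mono_map j (stretch_target cP) (mono_map j (unstretch_target c) p) =
    'X_j * mono_map j (unshift c) p by exact: E.
elim/mpolyind: p => [|a m p _ _ IH]; first by rewrite !linear0 mulr0 addr0.
rewrite !linearP /= mulrDr -scalerAr -IH addrACA -scalerDr; congr (_ *: _ + _).
rewrite !mono_mapX /=.
(* Exponent 0 is not reached by x_j: there H vanishes, and [F1] and [G1] fix the monomial. *)
case mE: (m j) => [|e] /=.
  by rewrite mono_mapX set_expE /= fiber_min0 set_exp_set -mE set_exp_id subrr mulr0.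
rewrite /unstretch_source; case: eqP => [_|jump].
  by rewrite linear0 subr0 -mpolyXD -set_exp_mulX -mE set_exp_id.
rewrite mono_mapX set_expE /=; case: (stretchS cP e) => // cE.
by rewrite (fiber_min_jump cP cE) set_exp_set -mE set_exp_id subrr mulr0.
Qed.

Let GF0 : cancel F0 G0.
Proof.
suff E (p : S) : mono_map j (unstretch_source c) (mono_map j (stretch_source cP) p) = p
  by exact: E.
elim/mpolyind: p => [|a m p _ _ IH]; first by rewrite !linear0.
rewrite !linearP /= IH mono_mapX mono_mapX set_expE /unstretch_source.
case: (fiber_minS cP (m j)) => e Ee cE; rewrite Ee /= -Ee fiber_minK cE.
by rewrite gtn_eqF // set_exp_set set_exp_id.
Qed.

Let GF1 : cancel F1 G1.
Proof.
suff E (p : S) : mono_map j (unstretch_target c) (mono_map j (stretch_target cP) p) = p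
  by exact: E.
elim/mpolyind: p => [|a m p _ _ IH]; first by rewrite !linear0.
rewrite !linearP /= IH mono_mapX mono_mapX set_expE.
case mE: (m j) => [|k]; first by rewrite fiber_min0 /= set_exp_set -mE set_exp_id.
case: (fiber_minS cP k) => e Ee cE; rewrite Ee /= /unstretch_source -Ee fiber_minK cE.
by rewrite gtn_eqF //= set_exp_set -mE set_exp_id.
Qed.

Let F_in (L L' : ideal K n) (v : S^o) : monomial_ideal L' -> stretched c L L' ->
  v \in L' -> F0 v \in L /\ F1 v \in L.
Proof.
move=> mL' cL L'v; split; apply: mono_map_in L'v => // m k L'm [<-].
  rewrite cL set_expE set_exp_set; case: (fiber_minS cP (m j)) => e -> /= ->.
  by rewrite set_exp_id.
by rewrite cL set_expE set_exp_set fiber_minK set_exp_id.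
Qed.

Let G_in (L L' : ideal K n) (v : S^o) : monomial_ideal L -> stretched c L L' ->
  v \in L -> G0 v \in L' /\ G1 v \in L'.
Proof.
move=> mL cL Lv; split; apply: mono_map_in Lv => // m k; rewrite cL.
  by rewrite /unstretch_source; case: eqP => // _ ? [<-].
case mE: (m j) => [|e] /=; first by rewrite stretch0 // => ? [<-].
rewrite /unstretch_source; case: eqP => // jump + [<-].
by case: (stretchS cP e) => // ->.
Qed.

(** Membership in L depends on the exponent e of x_j only through [c e], so division by x_j across a
    step of height 0 stays in L. *)
Let H_in (L L' : ideal K n) (v : S^o) : monomial_ideal L -> stretched c L L' ->
  v \in L -> H v \in L.
Proof.
move=> mL cL Lv; apply: mono_map_in Lv => // m k; rewrite !cL.
case mE: (m j) => [|e] //=; case: eqP => // cE + [<-].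
by rewrite set_expE set_exp_set cE.
Qed.

Lemma acyclic_below_stretched r :
  acyclic_below (V := S^o) ('X_j :: xs) r (fun p => p \in I) (fun p => p \in J) <->
  acyclic_below (V := S^o) ('X_j :: xs) r (fun p => p \in I') (fun p => p \in J').
Proof.
split.
  (* From I / J to I' / J': G F is the identity, so the homotopy is 0. *)
  apply: (@acyclic_below_cone _ _ _ _ _ _ _ _ _ G0 G1 F0 F1 (fun=> 0)) => //;
    try exact: ideal_submod; try exact: morphB; try by move=> y v; exact: comm.
  - by move=> u v; rewrite subr0.
  - by move=> y v _; rewrite scaler0.
  - by move=> v; rewrite GF0 subrr.
  - by move=> v; rewrite GF1 subrr scaler0.
  - by move=> v; apply: G_in.
  - by move=> v; apply: G_in.
  - by move=> v; apply: F_in.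
  - by move=> v; apply: F_in.
  - by move=> v _; exact: rpred0.
  - by move=> v _; exact: rpred0.
apply: (@acyclic_below_cone _ _ _ _ _ _ _ _ _ F0 F1 G0 G1 H) => //;
  try exact: ideal_submod; try exact: morphB; try by move=> y v; exact: comm.
- by move=> v; apply: F_in.
- by move=> v; apply: F_in.
- by move=> v; apply: G_in.
- by move=> v; apply: G_in.
- by move=> v; apply: H_in.
- by move=> v; apply: H_in.
Qed.
End Transfer.
End StretchedIdeals.

(** * Regular sequences on I / J *)

Section RegularSequences.
Variables (R : comNzRingType) (V : lmodType R).
Implicit Types (P Q : V -> Prop) (fs : seq R).

Lemma foldl_sum_mulP P Q fs v : foldl (sum_mul P) Q fs v <->
  exists w : 'I_(size fs) -> V, (forall i, P (w i)) /\ Q (v - \sum_(i < size fs) fs`_i *: w i).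
Proof.
elim: fs Q => [|f fs IH] Q /=.
  split=> [Qv|[w [_]]]; last by rewrite big_ord0 subr0.
  by exists (fun=> 0); split=> [[]//|]; rewrite big_ord0 subr0.
rewrite IH; split=> [[w [Pw [p [q [Pp Qq E]]]]]|[w [Pw Qw]]].
  exists (fun i => oapp w p (unlift ord0 i)); split.
    by move=> i; case: unliftP => [k _|_] /=.
  rewrite big_ord_recl unlift_none /= opprD addrA addrAC.
  under eq_bigr do rewrite liftK /=.
  by rewrite E addrAC subrr add0r.
exists (fun i => w (lift ord0 i)); split=> [i //|].
exists (w ord0), (v - \sum_(i < (size fs).+1) (f :: fs)`_i *: w i); split=> //.
by rewrite big_ord_recl /= opprD addrCA addNKr.
Qed.

Lemma regular_onP P Q fs : regular_on P Q fs <->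
  forall i, (i < size fs)%N -> nonzerodivisor P (foldl (sum_mul P) Q (take i fs)) fs`_i.
Proof.
elim: fs Q => [|f fs IH] Q //=; rewrite IH; split=> [[fP reg] [|i]|reg].
- by rewrite take0.
- exact: reg.
by split=> [|i]; [exact: (reg 0%N)|exact: (reg i.+1)].
Qed.
End RegularSequences.

Section FactorDepth.
Variables (K : fieldType) (n : nat).
Notation S := {mpoly K[n]}.
Implicit Types (I J : ideal K n) (fs : seq S).

Lemma val_lincomb I fs (y : 'I_(size fs) -> submodule I) :
  val (\sum_(i < size fs) fs`_i *: y i) = \sum_(i < size fs) fs`_i *: val (y i).
Proof. by rewrite raddf_sum. Qed.

Lemma in_mulmod_factor I J fs (x : submodule I) :
  in_mulmod (M := factor I J) fs (quotmod_class J x) <->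
  foldl (sum_mul (V := S^o) (fun p => p \in I)) (fun p => p \in J) fs (val x).
Proof.
rewrite foldl_sum_mulP; split=> [[w E]|[w [Iw Jw]]].
  exists (fun i => val (quotmod_repr (w i))); split=> [i|]; first exact: valP.
  have wE : quotmod_class J (\sum_(i < size fs) fs`_i *: quotmod_repr (w i)) =
      \sum_(i < size fs) fs`_i *: w i.
    by rewrite raddf_sum /=; apply: eq_bigr => i _; rewrite linearZ /= quotmod_reprK.
  by move: E; rewrite -wE => /quotmod_classP; rewrite val_lincomb.
exists (fun i => quotmod_class J (Sub (w i) (Iw i) : submodule I)).
under eq_bigr do rewrite -linearZ /=.
by rewrite -raddf_sum; apply/quotmod_classP; rewrite val_lincomb.
Qed.

Lemma regular_sequence_factor I J fs :
  (forall i, (i < size fs)%N -> forall v : factor I J,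
     in_mulmod (take i fs) (fs`_i *: v) -> in_mulmod (take i fs) v) <->
  regular_on (V := S^o) (fun p => p \in I) (fun p => p \in J) fs.
Proof.
rewrite regular_onP; split=> reg i lt_i v.
  move=> Iv; have := reg i lt_i (quotmod_class J (Sub v Iv : submodule I)).
  by rewrite -linearZ /= !in_mulmod_factor.
have [x ->] := quotmod_class_surj v; rewrite -linearZ /= !in_mulmod_factor.
by apply: reg => //; exact: valP.
Qed.

(** x_j is put first, so that the outermost cone of the Koszul complex is the one of x_j. *)
Lemma mem_graded_maximal_ideal (j : 'I_n) (f : S) :
  (f : S^o) \in graded_maximal_ideal K n <->
  span (V := S^o) ('X_j :: [seq 'X_i | i <- enum 'I_n & i != j]) f.
Proof.
set xs := _ :: _; have xsX i : 'X_i \in xs.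
  rewrite inE; case: (eqVneq i j) => [->|ne]; first by rewrite eqxx.
  apply/orP; right; apply/mapP; exists i => //.
  by rewrite mem_filter ne mem_enum.
split=> [/asboolP[s [sU ->]]|].
  rewrite big_seq; apply: (smod_sum (V := S^o)) => [|t /sU[i ->]].
    exact: (span_submod (V := S^o)).
  apply: (smodZ (V := S^o)); first exact: (span_submod (V := S^o)).
  exact: (mem_span (V := S^o)).
apply: (@span_min _ S^o xs (fun p => p \in graded_maximal_ideal K n)).
  exact: ideal_submod.
move=> x xxs; suff [i ->] : exists i : 'I_n, x = 'X_i.
  by apply: mem_monomial_span; exists i.
by move: xxs; rewrite inE => /orP[/eqP->|/mapP[i _ ->]]; [exists j|exists i].
Qed.

Lemma mem_graded_maximal_ideal0 (f : S) :
  (f : S^o) \in graded_maximal_ideal K n -> 0%MM \notin msupp f.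
Proof.
move=> mf; apply/negP => f0.
have mm : monomial_ideal (graded_maximal_ideal K n) by eexists.
move/(mem_monomial_ideal _ mm): mf => /(_ _ f0) /monomial_spanP[_ [i ->]].
by rewrite lep1mP mnm0E.
Qed.

Lemma exists_mingen I J : monomial_ideal I -> monomial_ideal J ->
  {subset J <= I} -> ~ (J =i I) ->
  exists2 u, mingens I u & ('X_[u] : S^o) \notin J.
Proof.
move=> mI mJ JI neq; apply: contrapT => no; apply: neq => f; apply/idP/idP => [/JI//|].
move/(mem_monomial_ideal _ mI) => fI; apply/(mem_monomial_ideal _ mJ) => m /fI Im.
have [u Iu um] := mingens_dvd Im; rewrite -(submK um) mpolyXD; apply: ideal_mull.
by apply/negPn/negP => Ju; apply: no; exists u.
Qed.

Lemma depth_factorP (j : 'I_n) I J r :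
  monomial_ideal I -> monomial_ideal J -> {subset J <= I} -> ~ (J =i I) ->
  (exists fs : seq S, [/\ size fs = r, {subset fs <= graded_maximal_ideal K n}
     & regular_sequence (factor I J) fs]) <->
  acyclic_below (V := S^o) ('X_j :: [seq 'X_i | i <- enum 'I_n & i != j]) r
    (fun p => p \in I) (fun p => p \in J).
Proof.
move=> mI mJ JI neq.
rewrite acyclic_below_regular; [|exact: mpoly_noetherian|exact: mpoly_noetherian
  |exact: ideal_submod|exact: ideal_submod].
split=> [[fs [sz fsm [reg _]]]|[fs [sz fsm reg]]]; exists fs; split=> //.
- by move=> f /fsm/mem_graded_maximal_ideal.
- exact/regular_sequence_factor.
- by move=> f /fsm/mem_graded_maximal_ideal.
split; first exact/regular_sequence_factor.
(* A monomial of positive degree times a monomial of I is never the minimal generator u. So x^u has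
   coefficient 0 in every element of (fs) I, and its class stays nonzero modulo [fs]. *)
have [u [Iu min_u] Ju] := exists_mingen mI mJ JI neq.
exists (quotmod_class J (Sub ('X_[u] : S^o) Iu : submodule I)).
rewrite in_mulmod_factor foldl_sum_mulP => -[w [Iw]] /=.
move/(mem_monomial_ideal _ mJ)=> /(_ u) H; move/negP: Ju; apply; apply: H.
rewrite mcoeff_msupp mcoeffB mcoeffX eqxx raddf_sum /= big1 ?subr0 ?oner_eq0 // => i _.
apply/eqP; rewrite mcoeff_eq0; apply/negP => /msuppM_le /allpairsP[[a b] /= [fa wb uE]].
have bu : b = u.
  apply: min_u; first by rewrite uE; exact: lem_addl.
  exact: (proj1 (mem_monomial_ideal _ mI) (Iw i)) b wb.
have a0 : a = 0%MM by apply: (@addIm _ u); rewrite add0m -{1}bu -uE.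
have := fsm fs`_i (mem_nth 0 (ltn_ord i)).
by move/mem_graded_maximal_ideal/mem_graded_maximal_ideal0; rewrite -a0 fa.
Qed.
End FactorDepth.

(** * The canonical step as a stretching *)

Section CanonicalStep.
Variables (K : fieldType) (n : nat) (I J : ideal K n) (j : 'I_n).
Notation S := {mpoly K[n]}.

(* canonical_exp is bounded: beyond the last entering power it is continued by
   counting every exponent, which makes it onto. *)
Definition counted l := enters I J j l \/ forall k, enters I J j k -> (k < l)%N.

Definition stretch_exp k := count (fun l => `[< counted l >]) (iota 1 k).

Lemma stretch_expS k : stretch_exp k.+1 = (stretch_exp k + `[< counted k.+1 >])%N.
Proof. by rewrite /stretch_exp -{1}[k.+1]addn1 iotaD count_cat /= addn0 add1n. Qed.

Lemma stretch_exp_homo : {homo stretch_exp : a b / (a <= b)%N}.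
Proof.
apply: (homo_leq (@leqnn)); first exact: leq_trans.
by move=> e; rewrite stretch_expS leq_addr.
Qed.

Lemma counted_unbounded N : exists2 l, (N < l)%N & counted l.
Proof.
have [[k ent lt_Nk]|no] := pselect (exists2 k, enters I J j k & (N < k)%N).
  by exists k => //; left.
exists N.+1 => //; right=> k ent; rewrite ltnS leqNgt; apply/negP => lt_Nk.
by apply: no; exists k.
Qed.

Lemma stretch_exp_stretching : stretching stretch_exp.
Proof.
split=> [//|e|k].
  by rewrite stretch_expS; case: asbool; [right; rewrite addn1|left; rewrite addn0].
have exk : exists e, (k <= stretch_exp e)%N.
  elim: k => [|k [e le_k]]; first by exists 0%N.
  have [[//|l] lt_el cl] := counted_unbounded e; exists l.+1.
  rewrite stretch_expS asboolT // addn1 ltnS.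
  by apply: leq_trans le_k _; apply: stretch_exp_homo.
case: (ex_minnP exk) => [[|e]] le_k min_e; first by exists 0%N; rewrite eqn_leq le_k leq0n.
exists e.+1; rewrite eqn_leq le_k andbT stretch_expS.
have: (stretch_exp e < k)%N by rewrite ltnNge; apply/negP => /min_e; rewrite ltnn.
by case: asbool; rewrite ?addn1 // addn0 => /ltnW.
Qed.

(** The exponents that [counted] adds exceed every entering power, so the two counts agree at the
    exponents of generators. *)
Lemma canonical_expE k : k = 0%N \/ enters I J j k -> canonical_exp I J j k = stretch_exp k.
Proof.
case=> [->//|entk]; apply: eq_in_count => l; rewrite mem_iota add1n ltnS => /andP[_ le_lk].
apply/asboolP/asboolP => [|[//|/(_ _ entk)]]; first by left.
by rewrite ltnNge le_lk.
Qed.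

(** An entering power is itself counted, so the count is strictly smaller before it. *)
Lemma stretch_exp_le k e : k = 0%N \/ enters I J j k ->
  (stretch_exp k <= stretch_exp e)%N = (k <= e)%N.
Proof.
case=> [->//|entk]; apply/idP/idP => [|/stretch_exp_homo//].
apply: contraLR; rewrite -!ltnNge; case: k entk => // k entk lt_ek.
rewrite stretch_expS asboolT; last by left.
by rewrite addn1 ltnS; apply: stretch_exp_homo.
Qed.

(** Membership is divisibility by a minimal generator, and by [stretch_exp_le] divisibility survives
    the compression of exponents. One count of the powers from both ideals serves I and J alike. *)
Lemma canonical_step_stretched (L : ideal K n) : L = I \/ L = J ->
  stretched j stretch_exp L
    (monomial_gen (fun v => exists2 u, mingens L u & v = canonical_mon I J j u)).
Proof.
move=> LIJ m.
have entL u : mingens L u -> u j = 0%N \/ enters I J j (u j).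
  move=> Lu; case: (posnP (u j)) => [->|lt_u]; [by left|right; split=> //].
  by exists u => //; case: LIJ => <-; [left|right].
have leE u : mingens L u ->
    (canonical_mon I J j u <= set_exp j (stretch_exp (m j)) m)%MM = (u <= m)%MM.
  move=> /entL Lu; apply: eq_forallb => i; rewrite !mnmE.
  by case: eqP => // ->; rewrite canonical_expE // stretch_exp_le.
apply/idP/idP => [Lm|/monomial_spanP[_ [u Lu ->]]].
  have [u Lu um] := mingens_dvd Lm; apply/monomial_spanP.
  by exists (canonical_mon I J j u); [exists u|rewrite leE].
rewrite leE // => um; rewrite -(submK um) mpolyXD; apply: ideal_mull.
by case: Lu.
Qed.
End CanonicalStep.

Section StretchedFactor.
Variables (K : fieldType) (n : nat) (j : 'I_n) (c : nat -> nat) (cP : stretching c).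
Variables I J I' J' : ideal K n.
Hypotheses (mI : monomial_ideal I) (mJ : monomial_ideal J).
Hypotheses (mI' : monomial_ideal I') (mJ' : monomial_ideal J').
Hypotheses (cI : stretched j c I I') (cJ : stretched j c J J').
Hypotheses (JI : {subset J <= I}) (neq : ~ (J =i I)).
Notation S := {mpoly K[n]}.

(** As [fiber_min] is a section of c, L' is in turn pulled back from L. *)
Lemma stretched_fiber_min (L L' : ideal K n) m : stretched j c L L' ->
  (('X_[m] : S^o) \in L') = (('X_[set_exp j (fiber_min cP (m j)) m] : S^o) \in L).
Proof. by move=> ->; rewrite set_expE fiber_minK set_exp_set set_exp_id. Qed.

Lemma stretched_subset : {subset J' <= I'}.
Proof.
move=> p /(mem_monomial_ideal _ mJ') pJ; apply/(mem_monomial_ideal _ mI') => m /pJ.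
by rewrite (stretched_fiber_min _ cJ) (stretched_fiber_min _ cI); apply: JI.
Qed.

Lemma stretched_neq : ~ (J' =i I').
Proof.
move=> eqIJ; apply: neq => p; apply/idP/idP => [/JI//|].
move/(mem_monomial_ideal _ mI) => pI; apply/(mem_monomial_ideal _ mJ) => m /pI.
by rewrite cI cJ eqIJ.
Qed.

(** The lengths of regular sequences are the same on both sides, so [natmax] is applied to equal
    predicates. *)
Lemma depth_stretched : depth (factor I J) = depth (factor I' J').
Proof.
rewrite /depth; congr natmax; apply/funext => r; apply/propext.
rewrite !(depth_factorP j) //; [|exact: stretched_subset|exact: stretched_neq].
apply: (acyclic_below_stretched cP) => // x /mapP[i]; rewrite mem_filter => /andP[ne _] ->.
by exists i.
Qed.
End StretchedFactor.

(** * Stanley depth of stretched factors *)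

Section Cones.
Variable n : nat.
Implicit Types (b m : 'X_{1..n}) (t : 'X_{1..n} * {set 'I_n}) (A : 'X_{1..n} -> bool).

(* The exponents of the monomials in u K[Z], for t = (u, Z). *)
Definition in_cone t b :=
  [forall i, (t.1 i <= b i)%N && ((i \in t.2) || (t.1 i == b i))].

Lemma in_coneP t b :
  reflect ((t.1 <= b)%MM /\ forall i, i \notin t.2 -> t.1 i = b i) (in_cone t b).
Proof.
apply: (iffP forallP) => [tb|[/mnm_lepP tb nt] i].
  split=> [|i nti]; first by apply/mnm_lepP => i; case/andP: (tb i).
  by have /andP[_] := tb i; rewrite (negPf nti) => /eqP.
by rewrite tb; case: (boolP (i \in t.2)) => //= /nt ->.
Qed.

Lemma in_cone_apex t : in_cone t t.1.
Proof. by apply/in_coneP; split=> //; exact: lepm_refl. Qed.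

(** [A b] counts as 0 or 1: this expresses covering, disjointness and containment in A together. *)
Definition cone_partition A (s : seq ('X_{1..n} * {set 'I_n})) :=
  forall b, count (fun t => in_cone t b) s = A b.

Definition partition_depth A d :=
  exists2 s, cone_partition A s & forall t, t \in s -> (d <= #|t.2|)%N.

Section Pullback.
Variables (j : 'I_n) (g : nat -> nat).
Hypothesis g_homo : {homo g : a b / (a <= b)%N}.
Hypothesis g_unbounded : forall v, exists e, (v <= g e)%N.

Let thr v := ex_minn (g_unbounded v).

Let thr_le v e : (thr v <= e)%N = (v <= g e)%N.
Proof.
rewrite /thr; case: ex_minnP => e0 le_v min_e0; apply/idP/idP => [/g_homo|/min_e0//].
exact: leq_trans.
Qed.

(** The preimage of u K[Z] under g in x_j is a union of cones with the same Z. If x_j is in Z, it is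
    one cone starting at the threshold of u_j; otherwise there is one cone for each e with g e =
    u_j, and all these e lie below [thr] of u_j + 1. *)
Let preimage t := if j \in t.2 then [:: (set_exp j (thr (t.1 j)) t.1, t.2)] else
  [seq (set_exp j e t.1, t.2) | e <- iota 0 (thr (t.1 j).+1) & g e == t.1 j].

Let in_cone_away t b := [forall (i | i != j), (t.1 i <= b i)%N && ((i \in t.2) || (t.1 i == b i))].

Let in_coneE t b :
  in_cone t b = ((t.1 j <= b j)%N && ((j \in t.2) || (t.1 j == b j))) && in_cone_away t b.
Proof.
apply/forallP/andP => [tb|[tbj /forall_inP tb] i].
  by split; [exact: tb|apply/forall_inP => i _; exact: tb].
by case: (eqVneq i j) => [->|/tb].
Qed.

Let in_cone_away_set t b e e' :
  in_cone_away (set_exp j e t.1, t.2) b = in_cone_away t (set_exp j e' b).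
Proof.
apply: eq_forallb => i; case: (eqVneq i j) => //= ne.
by rewrite !mnmE (negPf ne).
Qed.

Let count_preimage t b :
  count (fun t' => in_cone t' b) (preimage t) = in_cone t (set_exp j (g (b j)) b).
Proof.
rewrite /preimage in_coneE set_expE; case: ifP => jt.
  by rewrite /= addn0 in_coneE set_expE jt !andbT (in_cone_away_set _ _ _ (g (b j))) thr_le.
rewrite count_map; set aw := in_cone_away t _.
rewrite (eq_count (a2 := fun e => (e == b j) && aw)); last first.
  move=> e; rewrite /= in_coneE (in_cone_away_set _ _ _ (g (b j))) set_expE jt /= -/aw.
  by congr (_ && _); case: eqP => [->|]; rewrite ?leqnn ?andbF.
case: aw; last first.
  by rewrite andbF; under eq_count do rewrite andbF; exact: count_pred0.
under eq_count do rewrite andbT.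
rewrite andbT -/(pred1 (b j)) count_uniq_mem ?filter_uniq ?iota_uniq //.
rewrite mem_filter mem_iota add0n /= [g _ == _]eq_sym.
case: eqP => [->|]; last by rewrite andbF.
by rewrite leqnn ltnNge thr_le ltnn.
Qed.

(** Applied with g = c and with g = [fiber_min], this gives both inequalities between the Stanley
    depths. *)
Lemma partition_depth_pullback A d :
  partition_depth A d -> partition_depth (fun b => A (set_exp j (g (b j)) b)) d.
Proof.
case=> s sA sd; exists (flatten (map preimage s)) => [b|t /flattenP[_ /mapP[t' /sd le_d ->]]].
  rewrite count_flatten -map_comp -sA /= -sumn_count; congr sumn.
  by apply: eq_map => t; exact: count_preimage.
rewrite /preimage; case: ifP => _; first by rewrite inE => /eqP->.
by case/mapP => e _ ->.
Qed.
End Pullback.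
End Cones.

(** A common maximum is clear. The default value of [natmax] needs care: a bounded predicate without
    largest element is empty, then so is the other one, and the two are equal. *)
Lemma natmax_eq n (P P' : nat -> Prop) :
  (forall d, P d -> (d <= n)%N) -> (forall d, P' d -> (d <= n)%N) ->
  (forall d, P d -> exists2 d', P' d' & (d <= d')%N) ->
  (forall d, P' d -> exists2 d', P d' & (d <= d')%N) ->
  natmax P = natmax P'.
Proof.
move=> Pn Pn' PP' P'P.
have [[m [Pm maxm]]|noP] := pselect (exists m, P m /\ forall k, P k -> (k <= m)%N).
  have P'm : P' m.
    have [d P'd le_md] := PP' m Pm; have [e Pe le_de] := P'P d P'd.
    suff -> : m = d by [].
    by apply/eqP; rewrite eqn_leq le_md (leq_trans le_de (maxm _ Pe)).
  rewrite (natmaxP Pm maxm) (natmaxP P'm) // => k /P'P[e /maxm le_em le_ke].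
  exact: leq_trans le_em.
have noQ Q : (forall d, Q d -> (d <= n)%N) ->
    ~ (exists m, Q m /\ forall k, Q k -> (k <= m)%N) -> forall d, ~ Q d.
  move=> Qn noQ d Qd; apply: noQ.
  have exQ : exists d, `[< Q d >] by exists d; apply/asboolP.
  have bQ d' : `[< Q d' >] -> (d' <= n)%N by move/asboolP/Qn.
  case: (ex_maxnP exQ bQ) => m /asboolP Qm maxm.
  by exists m; split=> // k /asboolP/maxm.
have eqP0 (Q : nat -> Prop) : (forall d, ~ Q d) -> Q = fun=> False.
  by move=> nQ; apply/funext => d; apply/propext; split=> // /nQ.
have nP := noQ P Pn noP.
by rewrite (eqP0 P nP) (eqP0 P') // => d /P'P[e /nP].
Qed.

Lemma leq_big_minn (r d n : nat) (F : 'I_r -> nat) :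
  (d <= \big[minn/n]_(i < r) F i)%N <-> (d <= n)%N /\ forall i, (d <= F i)%N.
Proof.
split=> [|[dn dF]]; last by elim/big_ind: _ => // x y; rewrite leq_min => -> ->.
move=> le_d; suff H (s : seq 'I_r) : (d <= \big[minn/n]_(i <- s) F i)%N ->
    (d <= n)%N /\ forall i, i \in s -> (d <= F i)%N.
  by have [? dF] := H _ le_d; split=> // i; apply: dF; exact: mem_index_enum.
elim: s => [|i s IH]; first by rewrite big_nil.
rewrite big_cons leq_min => /andP[dFi /IH[dn ds]]; split=> // k.
by rewrite inE => /orP[/eqP->|/ds].
Qed.

(** * Stanley decompositions and partitions into cones *)

Section Decompositions.
Variables (K : fieldType) (n : nat).
Notation S := {mpoly K[n]}.
Implicit Types (p q : S) (Z : {set 'I_n}) (m a b : 'X_{1..n}).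

Lemma in_retractX Z (c : K) m : (forall i, i \notin Z -> m i = 0%N) ->
  in_retract Z (c *: 'X_[m] : S).
Proof. by move=> mZ m' /msuppZ_le; rewrite msuppX inE => /eqP ->. Qed.

Lemma in_retract_sum Z (T : Type) (s : seq T) (P : pred T) (F : T -> S) :
  (forall t, P t -> in_retract Z (F t)) -> in_retract Z (\sum_(t <- s | P t) F t).
Proof.
move=> FZ; apply: (big_ind (in_retract Z)) => // [|p q pZ qZ].
  by move=> m; rewrite msupp0.
by move=> m /msuppD_le; rewrite mem_cat => /orP[/pZ|/qZ].
Qed.

Lemma in_cone_supp Z p a b :
  in_retract Z p -> b \in msupp (p * 'X_[a]) -> in_cone (a, Z) b.
Proof.
move=> pZ; rewrite (perm_mem (msuppMX _ _)) => /mapP[m /pZ mZ ->].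
apply/in_coneP; split=> /= [|i /mZ]; first exact: lem_addr.
by rewrite mnmDE => ->; rewrite addn0.
Qed.

Lemma in_cone_subr Z a b : in_cone (a, Z) b -> forall i, i \notin Z -> (b - a)%MM i = 0%N.
Proof. by case/in_coneP => /= _ aZ i /aZ E; rewrite mnmBE E subnn. Qed.

Variables I J : ideal K n.
Hypotheses (mI : monomial_ideal I) (mJ : monomial_ideal J).

(** The exponents of the monomial K-basis of I / J. *)
Definition basis_exp b := (('X_[b] : S^o) \in I) && (('X_[b] : S^o) \notin J).

Lemma quotmod_class0 (x : submodule I) : quotmod_class J x = 0 <-> val x \in J.
Proof.
rewrite -(raddf0 (quotmod_class J)) quotmod_classP.
by have -> : val x - val (0 : submodule I) = val x by exact: subr0.
Qed.

Lemma mem_monomialZ (L : ideal K n) (c : K) b : monomial_ideal L -> c != 0 ->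
  ((c *: 'X_[b] : S) : S^o) \in L -> ('X_[b] : S^o) \in L.
Proof.
by move=> mL c0 /(mem_monomial_ideal _ mL) /(_ b); apply; rewrite msuppMCX ?inE.
Qed.

(** [u i] is the class of a nonzero multiple of x^(a i). The annihilator condition keeps the cone of
    (a i, Z i) out of J, spanning makes the cones cover the basis, and directness makes them
    disjoint. *)
Lemma partition_of_decomposition r (Z : 'I_r -> {set 'I_n}) (u : 'I_r -> factor I J) :
  stanley_decomposition (@factor_homogeneous _ _ I J) Z u ->
  partition_depth basis_exp (sdepth_decomposition Z).
Proof.
case=> hom ann spn dir.
have /choice[x] : forall i, exists x : submodule I, exists a c,
    u i = quotmod_class J x /\ val x = c *: 'X_[a] :> S.
  move=> i; have [a [x ux [c xE]]] := hom i.
  by exists x, a, c; rewrite xE mul_mpolyC.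
move=> /choice[a] /choice[c] /all_and2[ux xE].
have smulE i p : p *: u i = quotmod_class J (p *: x i) by rewrite ux linearZ.
have val_smul i p : val (p *: x i) = p * (c i *: 'X_[a i]) :> S.
  by rewrite -xE.
have c0 i : c i != 0.
  apply/eqP => ci0; suff : (1 : S) = 0 by move/eqP; rewrite oner_eq0.
  apply: (ann i); first by move=> m; rewrite msupp1 inE => /eqP-> k _; rewrite mnm0E.
  rewrite smulE; apply/quotmod_class0; have -> : val (1 *: x i) = 0 :> S.
    by rewrite val_smul ci0 scale0r mulr0.
  exact: rpred0.
have mulX i b (d : K) : (a i <= b)%MM ->
    (d *: 'X_[b - a i]) * (c i *: 'X_[a i]) = (d * c i) *: 'X_[b] :> S.
  by move=> le_ab; rewrite -scalerAl -scalerAr -mpolyXD submK // scalerA.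
have nzX i b (d : K) : in_cone (a i, Z i) b -> d != 0 -> (d *: 'X_[b - a i]) *: u i <> 0.
  move=> ib d0 E0; have := ann i _ (in_retractX (c := d) (in_cone_subr ib)) E0.
  move/(congr1 (mcoeff (b - a i)%MM)); rewrite mcoeffZ mcoeffX eqxx mulr1 mcoeff0.
  by move/eqP; rewrite (negPf d0).
have coneA i b : in_cone (a i, Z i) b -> basis_exp b.
  move=> ib; have [/= le_ab _] := in_coneP _ _ ib.
  have vE : val ((1 *: 'X_[b - a i]) *: x i) = c i *: 'X_[b] :> S.
    by rewrite val_smul mulX // mul1r.
  apply/andP; split.
    apply: (mem_monomialZ mI (c0 i)); rewrite -vE; exact: valP.
  apply/negP => Jb; apply: (nzX i b 1 ib); first exact: oner_neq0.
  rewrite smulE; apply/quotmod_class0.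
  have -> : val ((1 *: 'X_[b - a i]) *: x i) = c i *: 'X_[b] :> S by [].
  by rewrite -mul_mpolyC; apply: ideal_mull.
have coverA b : basis_exp b -> exists i, in_cone (a i, Z i) b.
  case/andP => Ib Jb.
  have [p pZ] := spn (quotmod_class J (Sub ('X_[b] : S^o) Ib : submodule I)).
  under eq_bigr do rewrite smulE; rewrite -raddf_sum => /quotmod_classP.
  rewrite raddf_sum /= => /(mem_monomial_ideal _ mJ)/(_ b) Jx.
  apply: contrapT => no; move/negP: Jb; apply; apply: Jx.
  rewrite mcoeff_msupp mcoeffB mcoeffX eqxx raddf_sum big1 ?subr0 ?oner_eq0 // => i _.
  have -> : p i *: sval (x i) = c i *: (p i * 'X_[a i]) :> S.
    by rewrite scalerAr; exact: val_smul.
  apply/eqP; rewrite mcoeff_eq0; apply/negP => /msuppZ_le bp; apply: no; exists i.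
  exact: in_cone_supp (pZ i) bp.
have disjA i k b : in_cone (a i, Z i) b -> in_cone (a k, Z k) b -> i = k.
  move=> ib kb; apply/eqP/negPn/negP => ne; have /andP[Ib _] := coneA i b ib.
  pose e := quotmod_class J (Sub ('X_[b] : S^o) Ib : submodule I).
  have eE l : in_cone (a l, Z l) b -> ((c l)^-1 *: 'X_[b - a l]) *: u l = e.
    case/in_coneP => /= le_ab _; rewrite smulE; apply/quotmod_classP.
    have -> : val (((c l)^-1 *: 'X_[b - a l]) *: x l) = 'X_[b] :> S.
      by rewrite val_smul mulX // mulVf ?c0 // scale1r.
    by rewrite /= subrr; exact: rpred0.
  (* If x^b lies in the cones of i and k, its class e arises from both summands; p encodes the
     relation e - e = 0. *)
  pose p l : S := if l == i then (c i)^-1 *: 'X_[b - a i] else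
    if l == k then - (c k)^-1 *: 'X_[b - a k] else 0.
  have pZ l : in_retract (Z l) (p l).
    rewrite /p; case: eqP => [->|_]; first exact: in_retractX (in_cone_subr ib).
    case: eqP => [->|_]; first exact: in_retractX (in_cone_subr kb).
    by move=> m; rewrite msupp0.
  have := dir p pZ; rewrite (bigD1 i) //= (bigD1 k) 1?eq_sym //= big1 => [|l /andP[li lk]].
    rewrite /p eqxx [k == i]eq_sym (negPf ne) eqxx scaleNr scaleNr !eE // addr0 subrr.
    move=> /(_ erefl i); rewrite eqxx; apply: nzX => //.
    by rewrite invr_eq0 c0.
  by rewrite /p (negPf li) (negPf lk) scale0r.
exists [seq (a i, Z i) | i <- enum 'I_r] => [b|t /mapP[i _ ->] /=]; last first.
  by have [_ ->] := (leq_big_minn _ _ _).1 (leqnn (sdepth_decomposition Z)).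
rewrite count_map; case: (boolP (basis_exp b)) => [/coverA[i ib]|nb].
  rewrite (eq_count (a2 := pred1 i)) => [|k /=].
    by rewrite count_uniq_mem ?enum_uniq // mem_enum.
  by apply/idP/eqP => [kb|->//]; exact: disjA kb ib.
rewrite (eq_count (a2 := pred0)) ?count_pred0 // => k /=.
by apply/negP => /coneA; apply/negP.
Qed.

(** The generators are the classes of the apex monomials. The bound [d <= n] covers the empty
    partition, whose depth is the default value n. *)
Lemma decomposition_of_partition d : (d <= n)%N -> partition_depth basis_exp d ->
  exists (r : nat) (Z : 'I_r -> {set 'I_n}) (u : 'I_r -> factor I J),
    stanley_decomposition (@factor_homogeneous _ _ I J) Z u /\
    (d <= sdepth_decomposition Z)%N.
Proof.
move=> dn [s sA sd]; pose t := tnth (in_tuple s).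
pose a i := (t i).1; pose Z i := (t i).2.
have sumA b : (\sum_(i < size s) in_cone (a i, Z i) b)%N = basis_exp b.
  rewrite -sA -sum1_count [RHS]big_mkcond [RHS](big_tnth _ _ s) /=.
  by apply: eq_bigr => i _; rewrite /a /Z -surjective_pairing; case: in_cone.
have coneA i b : in_cone (a i, Z i) b -> basis_exp b.
  move=> ib; have := sumA b; rewrite (bigD1 i) //= ib.
  by case: (basis_exp b).
have disjA i k b : in_cone (a i, Z i) b -> in_cone (a k, Z k) b -> k = i.
  move=> ib kb; apply/eqP/negPn/negP => ne; have := sumA b.
  by rewrite (bigD1 i) //= (bigD1 k) //= ib kb; case: (basis_exp b).
have Ia i : ('X_[a i] : S^o) \in I by case/andP: (coneA i _ (in_cone_apex (a i, Z i))).
pose x i : submodule I := Sub ('X_[a i] : S^o) (Ia i).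
pose u i : factor I J := quotmod_class J (x i).
have sum0 (p : 'I_(size s) -> S) : \sum_(i < size s) p i *: u i = 0 ->
    ((\sum_(i < size s) p i * 'X_[a i] : S) : S^o) \in J.
  under eq_bigr do rewrite /u -linearZ; rewrite -raddf_sum => /quotmod_class0.
  by rewrite raddf_sum.
have smul0 i (p : S) : p *: u i = 0 -> ((p * 'X_[a i] : S) : S^o) \in J.
  by rewrite /u -linearZ => /quotmod_class0.
have supp_mul p m i : m \in msupp p -> (a i + m)%MM \in msupp (p * 'X_[a i]).
  by move=> mp; rewrite (perm_mem (msuppMX _ _)); apply/mapP; exists m.
exists (size s), Z, u; split; last first.
  apply/leq_big_minn; split=> // i; apply: sd; exact: mem_tnth.
split=> [i|i p pZ|v|p pZ].
- exists (a i), (x i) => //; exists 1; by rewrite mpolyC1 mul1r.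
- move/smul0/(mem_monomial_ideal _ mJ) => pJ; apply/eqP/negPn/negP => p0.
  have := supp_mul _ _ i (mlead_supp p0) => ap.
  by have /coneA/andP[_ /negP] := in_cone_supp pZ ap; apply; exact: pJ.
- have [y ->] := quotmod_class_surj v; pose f : S := val y.
  (* Sort the monomials of f by the cones that contain them and divide by x^(a i). The terms left
     over have exponents outside [basis_exp]; as f is in I, they lie in J. *)
  exists (fun i => \sum_(b <- msupp f | in_cone (a i, Z i) b) f@_b *: 'X_[b - a i]).
    move=> i; apply: in_retract_sum => b ib; apply: in_retractX.
    exact: in_cone_subr ib.
  under eq_bigr do rewrite /u -linearZ; rewrite -raddf_sum; apply/quotmod_classP.
  rewrite raddf_sum /= -/f.
  have -> : \sum_(i < size s) (\sum_(b <- msupp f | in_cone (a i, Z i) b)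
      f@_b *: 'X_[b - a i]) *: ('X_[a i] : S^o) =
      \sum_(b <- msupp f | basis_exp b) f@_b *: 'X_[b] :> S.
    under eq_bigr => i _.
      have -> : (\sum_(b <- msupp f | in_cone (a i, Z i) b) f@_b *: 'X_[b - a i])
          *: ('X_[a i] : S^o) = \sum_(b <- msupp f)
          (f@_b *: 'X_[b]) *+ in_cone (a i, Z i) b :> S.
        rewrite /GRing.scale /= mulr_suml big_mkcond; apply: eq_bigr => b _.
        case: (boolP (in_cone _ _)) => //= /in_coneP[/= le_ab _].
        by rewrite -scalerAl -mpolyXD submK.
      over.
    rewrite exchange_big [RHS]big_mkcond; apply: eq_bigr => b _.
    by rewrite sumrMnr sumA; case: basis_exp.
  have -> : f - \sum_(b <- msupp f | basis_exp b) f@_b *: 'X_[b] =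
      \sum_(b <- msupp f | ~~ basis_exp b) f@_b *: 'X_[b].
    by rewrite {1}[f]mpolyE (bigID basis_exp) /= addrC addrK.
  rewrite big_seq_cond; apply: (rpred_sum (S := J)) => b /andP[fb].
  rewrite /basis_exp negb_and negbK -mul_mpolyC => /orP[/negP nIb|Jb]; apply: ideal_mull => //.
  by case: nIb; apply: (proj1 (mem_monomial_ideal _ mI) (valP y)).
move/sum0/(mem_monomial_ideal _ mJ) => pJ i.
(* By disjointness the leading monomial of p_i x^(a i) occurs in no other summand, so it would lie
   in J, which its cone avoids. *)
suff -> : p i = 0 by rewrite scale0r.
apply/eqP/negPn/negP => p0; have ap := supp_mul _ _ i (mlead_supp p0).
have ib := in_cone_supp (pZ i) ap; have /andP[_ /negP] := coneA _ _ ib; apply; apply: pJ.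
rewrite mcoeff_msupp raddf_sum (bigD1 i) //= big1 ?addr0 -?mcoeff_msupp // => k ne.
apply/eqP; rewrite mcoeff_eq0; apply/negP => /(in_cone_supp (pZ k)) kb.
by move/eqP: ne; apply; exact: disjA ib kb.
Qed.

Lemma sdepth_bounds d :
  (exists (r : nat) (Z : 'I_r -> {set 'I_n}) (u : 'I_r -> factor I J),
    stanley_decomposition (@factor_homogeneous _ _ I J) Z u /\ sdepth_decomposition Z = d) ->
  (d <= n)%N /\ partition_depth basis_exp d.
Proof.
case=> r [Z [u [ZuP <-]]]; split; last exact: partition_of_decomposition ZuP.
by have [] := (leq_big_minn _ _ _).1 (leqnn (sdepth_decomposition Z)).
Qed.
End Decompositions.

(** Each [basis_exp] is the pullback of the other one. The decomposition rebuilt from a partition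
    may exceed the bound d, hence the comparison by [natmax_eq]. *)
Lemma sdepth_stretched (K : fieldType) (n : nat) (j : 'I_n) (c : nat -> nat)
  (I J I' J' : ideal K n) : stretching c ->
  monomial_ideal I -> monomial_ideal J -> monomial_ideal I' -> monomial_ideal J' ->
  stretched j c I I' -> stretched j c J J' ->
  sdepth (@factor_homogeneous _ _ I J) = sdepth (@factor_homogeneous _ _ I' J').
Proof.
move=> cP mI mJ mI' mJ' cI cJ.
have bE : basis_exp I J = fun b => basis_exp I' J' (set_exp j (c (b j)) b).
  by apply/funext => b; rewrite /basis_exp cI cJ.
have bE' : basis_exp I' J' = fun b => basis_exp I J (set_exp j (fiber_min cP (b j)) b).
  apply/funext => b; rewrite /basis_exp.
  by rewrite (stretched_fiber_min cP _ cI) (stretched_fiber_min cP _ cJ).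
have c_unbounded v : exists e, (v <= c e)%N by exists (fiber_min cP v); rewrite fiber_minK.
have fiber_min_unbounded v : exists e, (v <= fiber_min cP e)%N.
  (* c e is at most e, so v = c ([fiber_min] v) is at most [fiber_min] v. *)
  exists v; rewrite -{1}(fiber_minK cP v).
  elim: (fiber_min cP v) => [|e IH]; first by rewrite stretch0.
  by case: (stretchS cP e) => ->; rewrite ?ltnS // leqW.
apply: (@natmax_eq n) => d.
- by case/sdepth_bounds.
- by case/sdepth_bounds.
- case/sdepth_bounds => // dn /(partition_depth_pullback j (fiber_min_homo cP) fiber_min_unbounded).
  rewrite -bE' => /decomposition_of_partition[] // r [Z [u [ZuP le_d]]].
  by exists (sdepth_decomposition Z) => //; exists r, Z, u.
case/sdepth_bounds => // dn /(partition_depth_pullback j (stretch_homo cP) c_unbounded).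
rewrite -bE => /decomposition_of_partition[] // r [Z [u [ZuP le_d]]].
by exists (sdepth_decomposition Z) => //; exists r, Z, u.
Qed.

(** * Iteration over the variables *)

Definition proper_factor (K : fieldType) (n : nat) (IJ : ideal K n * ideal K n) :=
  [/\ monomial_ideal IJ.1, monomial_ideal IJ.2, {subset IJ.2 <= IJ.1} & ~ (IJ.2 =i IJ.1)].

Lemma canonical_step_proper (K : fieldType) (n : nat) (IJ : ideal K n * ideal K n) j :
  proper_factor IJ -> proper_factor (canonical_step IJ j).
Proof.
case: IJ => I J [/= mI mJ JI neq].
have sI := canonical_step_stretched (I := I) (J := J) j (or_introl erefl).
have sJ := canonical_step_stretched (I := I) (J := J) j (or_intror erefl).
have mgen A : monomial_ideal (monomial_gen A : ideal K n) by exists A.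
split; [exact: mgen|exact: mgen| |].
  exact: (stretched_subset (stretch_exp_stretching I J j) (mgen _) (mgen _) sI sJ JI).
exact: (stretched_neq mI mJ sI sJ JI neq).
Qed.

Lemma canonical_step_conjecture (K : fieldType) (n : nat) (IJ : ideal K n * ideal K n) j :
  proper_factor IJ ->
  stanley_conjecture IJ.1 IJ.2 <->
  stanley_conjecture (canonical_step IJ j).1 (canonical_step IJ j).2.
Proof.
case: IJ => I J [/= mI mJ JI neq].
have sI := canonical_step_stretched (I := I) (J := J) j (or_introl erefl).
have sJ := canonical_step_stretched (I := I) (J := J) j (or_intror erefl).
have mgen A : monomial_ideal (monomial_gen A : ideal K n) by exists A.
have cP := stretch_exp_stretching I J j.
rewrite /stanley_conjecture (depth_stretched cP mI mJ (mgen _) (mgen _) sI sJ JI neq).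
by rewrite (sdepth_stretched cP mI mJ (mgen _) (mgen _) sI sJ).
Qed.

Theorem theorem3 (K : fieldType) (n : nat) (I J : ideal K n)
  (I_monomial : monomial_ideal I) (J_monomial : monomial_ideal J)
  (J_sub_I : {subset J <= I}) (J_neq_I : ~ (J =i I)) :
  stanley_conjecture I J <->
  stanley_conjecture (canonical_form I J).1 (canonical_form I J).2.
Proof.
have : proper_factor (I, J) by [].
rewrite /canonical_form -[I in X in X <-> _]/((I, J).1) -[J in X in X <-> _]/((I, J).2).
(* Each step reads the entering powers off the current pair, so the induction on the list of
   variables keeps the pair general, with [proper_factor] as invariant. *)
elim: (enum 'I_n) (I, J) => [|j s IH] IJ properIJ //=.
rewrite canonical_step_conjecture //; apply: IH; exact: canonical_step_proper.
Qed.
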